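(* Let $k$ be even and $n\ge1$ with $2k^{7/2}\le n^2$, let $\pi=(\pi_t)_{t\in\{1,\ldots,T\}}$ be a partition of $\{1,\ldots,k\}$, and let $\varepsilon\in\{\cdot,-\}^k$ be a balanced sequence. For all $p,q\in P_k^\varepsilon$, $$|\mathrm{Wg}[\pi](p,q,n)|\le\left(1+3k^{7/2}n^{-2}\right)n^{-k/2-|pq^{-1}|}\,4^{|pq^{-1}|}\left(k^{7/4}n^{-1}\right)^r,$$ where $r$ is the number of blocks of $\pi$ to which $p\vee q$ can be restricted (that is, the number of blocks of $\pi$ which are unions of blocks of $p\vee q$).
   Context: The sequence $\varepsilon\in\{\cdot,-\}^k$ is balanced if it has as many $\cdot$ as $-$. $P_k^\varepsilon$ is the set of pair partitions of $\{1,\ldots,k\}$ each of whose pairs matches an index $i$ with $\varepsilon_i=\cdot$ to an index $i'$ with $\varepsilon_{i'}=-$; such a $p$ is identified with a bijection from $\{i:\varepsilon_i=\cdot\}$ to $\{i:\varepsilon_i=-\}$, so that $pq^{-1}$ is a permutation of a set with $k/2$ elements. For a permutation $\sigma$ of a finite set $S$, $|\sigma|=|S|-(\text{number of cycles of }\sigma)$. $p\vee q$ is the finest partition coarser than both $p$ and $q$. Weingarten functions. For $m\ge1$ and $n\ge m$, $\mathrm{Wg}(\cdot,n):S_m\to\mathbb{R}$ is the unitary Weingarten function, i.e. the unique central function such that, for $U$ Haar-distributed on $\mathbb{U}_n$, $\mathbf{E}\prod_{l=1}^mU_{x_ly_l}\overline U_{x'_ly'_l}=\sum_{p,q\in S_m}\prod_l\delta_{x_l,x'_{p(l)}}\prod_l\delta_{y_l,y'_{q(l)}}\mathrm{Wg}(pq^{-1},n)$.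 It is defined likewise for permutations of any $m$-element set (it depends only on the cycle type), and equals $1$ for the empty set. For $A\subset\{1,\ldots,T\}$ let $\pi_A$ be the partition of $\{1,\ldots,k\}$ obtained from $\pi$ by merging all blocks $\pi_t$, $t\in A$, into one block and keeping the others. A pair partition $p$ leaves a set $b$ invariant if no pair of $p$ has exactly one element in $b$. Set $\mathrm{Wg}_A[\pi](p,q,n)=0$ if $p$ or $q$ does not leave all blocks of $\pi_A$ invariant, and otherwise $\mathrm{Wg}_A[\pi](p,q,n)=\prod_{b\in\pi_A}\mathrm{Wg}(p_bq_b^{-1},n)$, where $p_b,q_b$ are the restrictions of $p,q$ to the block $b$. The centered Weingarten function is $$\mathrm{Wg}[\pi](p,q,n)=\sum_{A\subset\{1,\ldots,T\}}(-1)^{T-|A|}\,\mathrm{Wg}_A[\pi](p,q,n).$$ *)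

(* Defs.v *)
From HB Require Import structures.
From mathcomp Require Import all_boot all_order all_algebra all_fingroup.
From mathcomp Require Import spectral complex.

Set Implicit Arguments.
Unset Strict Implicit.
Unset Printing Implicit Defensive.

Import Order.TTheory GRing.Theory Num.Theory.
Local Open Scope ring_scope.

(* Sequences in {.,-}^k are encoded as boolean functions: [eps i] is [true]    *)
(* when the i-th sign is a dot and [false] when it is a minus. The set         *)
(* {1, ..., k} is 'I_k.                                                        *)

Definition balanced (k : nat) (eps : {ffun 'I_k -> bool}) : bool :=
  #|[set i | eps i]| == #|[set i | ~~ eps i]|.

Definition pairings (k : nat) (eps : {ffun 'I_k -> bool}) :
    {set {set {set 'I_k}}} :=
  [set p : {set {set 'I_k}} | partition p [set: 'I_k] &
     [forall c in p, exists i, exists i',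
        [&& eps i, ~~ eps i' & c == [set i; i']]]].

(* The element paired with [i] by [p] ([i] itself if there is none). *)
Definition partner (k : nat) (p : {set {set 'I_k}}) (i : 'I_k) : 'I_k :=
  odflt i [pick j in pblock p i :\ i].

Definition minus_in (k : nat) (eps : {ffun 'I_k -> bool}) (b : {set 'I_k}) :
    finType :=
  {i : 'I_k | (i \in b) && ~~ eps i}.

(* For pairings p, q of the set b (matching dots with minuses), seen as        *)
(* bijections from the dots of b to its minuses, this is p q^-1, a permutation *)
(* of the minuses of b; q^-1 sends a minus to its q-partner, and p sends the   *)
(* latter to its p-partner. The default value is never reached for such p, q.  *)
Definition pairing_quotient (k : nat) (eps : {ffun 'I_k -> bool})
    (b : {set 'I_k}) (p q : {set {set 'I_k}}) : {perm minus_in eps b} :=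
  odflt 1%g [pick s : {perm minus_in eps b} |
    [forall j, val (s j) == partner p (partner q (val j))]].

Definition perm_length (S : finType) (s : {perm S}) : nat :=
  #|S| - #|porbits s|.

Definition refines (k : nat) (P Q : {set {set 'I_k}}) : bool :=
  [forall b in P, exists c in Q, b \subset c].

(* P \/ Q is the finest partition coarser than both P and Q. It exists         *)
(* whenever P and Q are partitions, so the default value is then irrelevant.   *)
Definition is_pjoin (k : nat) (P Q J : {set {set 'I_k}}) : bool :=
  [&& partition J [set: 'I_k], refines P J, refines Q J &
      [forall J' : {set {set 'I_k}},
         [&& partition J' [set: 'I_k], refines P J' & refines Q J']
           ==> refines J J']].

Definition pjoin (k : nat) (P Q : {set {set 'I_k}}) : {set {set 'I_k}} :=
  odflt set0 [pick J | is_pjoin P Q J].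

(* [partition] forbids empty blocks, and injectivity forces the blocks indexed *)
(* by distinct t to be distinct, hence disjoint.                               *)
Definition blocks_partition (k T : nat) (pi : 'I_T -> {set 'I_k}) : Prop :=
  injective pi /\ partition [set pi t | t : 'I_T] [set: 'I_k].

Definition restrictible_blocks (k T : nat) (pi : 'I_T -> {set 'I_k})
    (p q : {set {set 'I_k}}) : {set 'I_T} :=
  [set t | [exists B : {set {set 'I_k}},
              (B \subset pjoin p q) && (pi t == cover B)]].

(* pi_A; nothing is merged (and no empty block is created) when A is empty. *)
Definition merge_blocks (k T : nat) (pi : 'I_T -> {set 'I_k}) (A : {set 'I_T}) :
    {set {set 'I_k}} :=
  [set pi t | t in ~: A] :|:
  (if A == set0 then set0 else [set \bigcup_(t in A) pi t]).

Definition leaves_invariant (k : nat) (p : {set {set 'I_k}}) (b : {set 'I_k}) :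
    bool :=
  [forall c in p, #|c :&: b| != 1%N].

(* [Wg S] is the Weingarten function on the permutations of the finite set S;  *)
(* [p ::&: b], the set of pairs of p contained in b, is the restriction of p.  *)
Definition WgA (R : nzRingType) (Wg : forall S : finType, {perm S} -> R)
    (k T : nat) (eps : {ffun 'I_k -> bool}) (pi : 'I_T -> {set 'I_k})
    (A : {set 'I_T}) (p q : {set {set 'I_k}}) : R :=
  if [forall b in merge_blocks pi A,
        leaves_invariant p b && leaves_invariant q b]
  then \prod_(b in merge_blocks pi A)
         Wg (minus_in eps b) (pairing_quotient eps b (p ::&: b) (q ::&: b))
  else 0.

Definition centered_Wg (R : nzRingType) (Wg : forall S : finType, {perm S} -> R)
    (k T : nat) (eps : {ffun 'I_k -> bool}) (pi : 'I_T -> {set 'I_k})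
    (p q : {set {set 'I_k}}) : R :=
  \sum_(A : {set 'I_T}) (-1) ^+ (T - #|A|) * WgA Wg eps pi A p q.

From mathcomp Require Import all_classical all_reals all_analysis.
Import numFieldNormedType.Exports.
Local Open Scope classical_set_scope.
Local Open Scope complex_scope.

Definition cmx_borel (R : realType) (n : nat) : set (set 'M[R[i]]_n) :=
  <<s @open 'M[(R[i] : numFieldType)]_n >>.

(* The law of U is a Borel probability measure carried by the unitary group    *)
(* and invariant under left translations, i.e. the normalized Haar measure.    *)
Definition haar_distributed (d : measure_display) (Omega : measurableType d)
    (R : realType) (P : probability Omega R) (n : nat)
    (U : Omega -> 'M[R[i]]_n) : Prop :=
  [/\ forall w, U w \is unitarymx,
      forall B, cmx_borel B -> measurable (U @^-1` B) &
      forall (V : 'M[R[i]]_n) (B : set 'M[R[i]]_n),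
        V \is unitarymx -> cmx_borel B ->
        P [set w | B (V *m U w)] = P [set w | B (U w)]].

Definition cexpectation (d : measure_display) (Omega : measurableType d)
    (R : realType) (P : probability Omega R) (X : Omega -> R[i]) : R[i] :=
  fine ('E_P[fun w => complex.Re (X w)])%E +i*
  fine ('E_P[fun w => complex.Im (X w)])%E.

(* The characteristic property of Wg(., n) on the permutations of a finite set *)
(* S (the indices l of the products range over S); for empty S it reads        *)
(* Wg = 1. MathComp composes permutations from left to right, so that p q^-1   *)
(* is written q^-1 * p.                                                        *)
Definition is_weingarten (d : measure_display) (Omega : measurableType d)
    (R : realType) (P : probability Omega R) (n : nat)
    (U : Omega -> 'M[R[i]]_n) (S : finType) (Wg : {perm S} -> R) : Prop :=
  (forall s t : {perm S}, Wg (s * t)%g = Wg (t * s)%g) /\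
  (forall x y x' y' : S -> 'I_n,
     cexpectation P (fun w =>
       \prod_l (U w (x l) (y l) * (U w (x' l) (y' l))^*)) =
     \sum_(p : {perm S}) \sum_(q : {perm S})
       (\prod_l (x l == x' (p l))%:R) * (\prod_l (y l == y' (q l))%:R) *
       (Wg (q^-1 * p)%g)%:C).

Definition weingarten_family (d : measure_display) (Omega : measurableType d)
    (R : realType) (P : probability Omega R) (n : nat)
    (U : Omega -> 'M[R[i]]_n) (Wg : forall S : finType, {perm S} -> R) : Prop :=
  forall S : finType, (#|S| <= n)%N -> is_weingarten P U (Wg S).

(* Main.v *)
(* Write F(D, s) for the Weingarten value of the restriction of s to an s-stable set D, expressed
   as a moment of U. Summing over one column index and using unitarity gives, for m in D,
     n F(D, s) + sum_(i in D, i != m) F(D, (i m) s) = [s m = m] F(D \ m, s).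
   Products over the blocks of pi_A satisfy the same relation restricted to the i lying in the
   same block of pi_A as m, so in the alternating sum over A only those A survive for which every
   unmerged block has not been crossed: the alternating sum X_Z, indexed by the set Z of blocks
   that still have to be crossed, satisfies a closed recursion in which each transposition (i m)
   between two blocks removes them from Z.
   X_Z is then compared with an explicit supersolution
     n^-(|D| + |s|) W(s) growth(|s| + |D|, #{z in Z | s preserves z}),
   where W(s) is the product of the Catalan numbers C_(a - 1) over the cycle lengths a of s. When
   (i m) splits a cycle, the weights W add up exactly to W(s) (Catalan recursion) and preserved
   blocks remain uncrossed; when it joins two cycles, W grows by at most k^(3/2), a factor n^-2
   is gained, and at most two preserved blocks are lost. Since n > |D| - 1 the recursion is a
   contraction and the comparison follows from a maximum principle, without any expansion in
   powers of 1/n. *)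
Require Import Defs.
From HB Require Import structures.
From mathcomp Require Import all_boot all_order all_algebra all_fingroup.
From mathcomp Require Import zify ring lra.

Set Implicit Arguments.
Unset Strict Implicit.
Unset Printing Implicit Defensive.

Import Order.TTheory GRing.Theory Num.Theory.
Local Open Scope ring_scope.

(** * Catalan numbers *)

Section Catalan.
Variable R : realFieldType.

(** The numbers binom(2n, n) / (n + 1), given by their ratios, so that growth estimates become
    inductions on a rational function. *)
Definition catalan (n : nat) : R := \prod_(i < n) ((4 * i%:R + 2) / (i%:R + 2)).

Lemma catalanS n : (n%:R + 2) * catalan n.+1 = (4 * n%:R + 2) * catalan n.
Proof.
have n0 : (0 : R) <= n%:R by exact: ler0n.
by rewrite /catalan big_ord_recr /=; field; lra.
Qed.

Lemma catalan0 : catalan 0 = 1.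
Proof. by rewrite /catalan big_ord0. Qed.

Lemma catalan_gt0 n : 0 < catalan n.
Proof.
apply: prodr_gt0 => i _.
have i0 : (0 : R) <= i%:R by exact: ler0n.
by rewrite divr_gt0 //; lra.
Qed.

(* By the symmetry i <-> n - i, (n + 2) conv_n = 2 sum (i + 1) C_i C_(n - i); expanding
   (i + 1) C_i by catalanS then relates conv_(n + 1) to conv_n. *)
Lemma catalan_conv n :
  \sum_(i < n.+1) catalan i * catalan (n - i) = catalan n.+1.
Proof.
pose S n := \sum_(i < n.+1) catalan i * catalan (n - i).
pose T n := \sum_(i < n.+1) i%:R * (catalan i * catalan (n - i)).
have symT m : 2 * T m = m%:R * S m.
  have rT : T m = \sum_(i < m.+1) (m - i)%:R * (catalan i * catalan (m - i)).
    rewrite /T (reindex_inj rev_ord_inj) /=; apply: eq_bigr => i _.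
    by rewrite subSS subKn ?[catalan i * _]mulrC // -ltnS.
  rewrite (_ : 2 * T m = T m + T m); last by ring.
  rewrite {2}rT /T -big_split /= /S mulr_sumr; apply: eq_bigr => i _.
  by rewrite -mulrDl -natrD subnKC // -ltnS.
have recS m : T m.+1 + S m.+1 = catalan m.+1 + (4 * T m + 2 * S m).
  rewrite /T /S -big_split big_ord_recl /= catalan0 mul0r add0r mul1r subn0.
  congr (_ + _); rewrite !mulr_sumr -big_split; apply: eq_bigr => i _ /=.
  rewrite /bump /= add1n subSS.
  transitivity ((i%:R + 2) * catalan i.+1 * catalan (m - i)); first by rewrite -natr1; ring.
  by rewrite catalanS; ring.
elim: n => [|n IH].
  rewrite big_ord1 subn0 catalan0; have := catalanS 0; rewrite catalan0; lra.
rewrite -/(S n.+1).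
have n0 : (0 : R) <= n%:R by exact: ler0n.
have := recS n; have := symT n; have := symT n.+1.
have := catalanS n.+1; rewrite -/(S n) in IH; rewrite IH -natr1.
move=> h1 h2 h3 h4.
have : (n%:R + 3) * S n.+1 = (n%:R + 3) * catalan n.+2 by nra.
by apply: mulfI; lra.
Qed.

Lemma catalan_le n : catalan n <= 4 ^+ n.
Proof.
elim: n => [|n IH]; first by rewrite catalan0.
have n0 : (0 : R) <= n%:R by exact: ler0n.
have := catalanS n; have := catalan_gt0 n; rewrite exprS => c0 h.
have h2 : (n%:R + 2) * catalan n.+1 <= (n%:R + 2) * (4 * 4 ^+ n) by nra.
by rewrite ler_pM2l in h2 => //; lra.
Qed.

(** C_n has order 4^n n^(-3/2); squaring avoids the half-integer power. The induction step is (4n +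
    2)^2 (n + 2) <= 16 (n + 1)^3. *)
Lemma catalan_sqr_le n : catalan n ^+ 2 * n.+1%:R ^+ 3 <= 16 ^+ n.
Proof.
elim: n => [|n IH]; first by rewrite catalan0; lra.
have n0 : (0 : R) <= n%:R by exact: ler0n.
move: IH; rewrite [16 ^+ n.+1]exprS -[n.+2%:R]natr1 -[n.+1%:R]natr1.
have := catalanS n; move: (catalan n) (catalan n.+1) (n%:R : R) n0 (16 ^+ n : R) => c c' x x0 y h IH.
have e : c' = (4 * x + 2) * c / (x + 2) by rewrite -h; field; lra.
have : (x + 1) ^+ 3 * (c' ^+ 2 * (x + 1 + 1) ^+ 3) <= (x + 1) ^+ 3 * (16 * y).
  apply: (@le_trans _ _ (16 * (x + 1) ^+ 3 * (c ^+ 2 * (x + 1) ^+ 3))); last first.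
    rewrite [leRHS](_ : _ = 16 * (x + 1) ^+ 3 * y); last by ring.
    by apply: ler_wpM2l => //; rewrite mulr_ge0 ?exprn_ge0 //; lra.
  rewrite [leLHS](_ : _ = (x + 1) ^+ 3 * c ^+ 2 * ((4 * x + 2) ^+ 2 * (x + 2))); last first.
    by rewrite e; field; lra.
  rewrite [leRHS](_ : _ = (x + 1) ^+ 3 * c ^+ 2 * (16 * (x + 1) ^+ 3)); last by ring.
  apply: ler_wpM2l; last by nra.
  by rewrite mulr_ge0 ?sqr_ge0 ?exprn_ge0 //; lra.
by rewrite ler_pM2l // exprn_gt0 //; lra.
Qed.

Lemma catalan_sqr_ge n : 16 ^+ n <= 4 * n.+1%:R ^+ 3 * catalan n ^+ 2.
Proof.
case: n => [|n]; first by rewrite catalan0; lra.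
(* C_n^2 (n + 1)^3 / 16^n decreases, so the stated bound does not pass from n to n + 1. With n (n +
   1)^2 in place of (n + 1)^3 the quotient increases, and there is equality at n = 1. *)
apply: (@le_trans _ _ (4 * n.+1%:R * n.+2%:R ^+ 2 * catalan n.+1 ^+ 2)); last first.
  rewrite ler_wpM2r ?sqr_ge0 // [leRHS](_ : _ = 4 * n.+2%:R * n.+2%:R ^+ 2); last by ring.
  by rewrite ler_wpM2r ?sqr_ge0 // ler_pM2l // ler_nat.
elim: n => [|n IH].
  have := catalanS 0; rewrite catalan0 => h.
  have -> : catalan 1 = 1 by lra.
  lra.
have n0 : (0 : R) <= n%:R by exact: ler0n.
move: IH; rewrite [16 ^+ n.+2]exprS -[n.+3%:R]natr1 -[n.+2%:R]natr1 -[n.+1%:R]natr1.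
have := catalanS n.+1; rewrite -[n.+1%:R]natr1.
move: (catalan n.+1) (catalan n.+2) (n%:R : R) n0 (16 ^+ n.+1 : R) => c c' x x0 y h IH.
have e : c' = (4 * x + 6) * c / (x + 3).
  by apply: (@mulfI _ (x + 1 + 2)); [lra|rewrite h; field; lra].
have : (x + 1) * (16 * y) <= (x + 1) * (4 * (x + 1 + 1) * (x + 1 + 1 + 1) ^+ 2 * c' ^+ 2).
  apply: (@le_trans _ _ (16 * (x + 1) * (4 * (x + 1) * (x + 1 + 1) ^+ 2 * c ^+ 2))).
    rewrite [leLHS](_ : _ = 16 * (x + 1) * y); last by ring.
    by apply: ler_wpM2l => //; lra.
  rewrite [leLHS](_ : _ = (c ^+ 2 * (x + 1) * (x + 2)) * (64 * (x + 1) * (x + 2))); last by ring.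
  rewrite [leRHS](_ : _ = (c ^+ 2 * (x + 1) * (x + 2)) * (4 * (4 * x + 6) ^+ 2)); last first.
    by rewrite e; field; lra.
  apply: ler_wpM2l; last by nra.
  by rewrite -mulrA mulr_ge0 ?sqr_ge0 ?mulr_ge0 //; lra.
by rewrite ler_pM2l //; lra.
Qed.

(** Controls the weight when cycles of lengths a = i + 1 and b = j + 1 merge. The upper bound for
    C_(i + j + 1) and the lower bounds for C_i and C_j leave 4 (4ab)^3 against 4 (a + b)^6, and 4ab
    <= (a + b)^2. *)
Lemma catalan_join i j :
  catalan (i + j).+1 ^+ 2 <= 4 * (i + j).+2%:R ^+ 3 * (catalan i * catalan j) ^+ 2.
Proof.
have up := catalan_sqr_le (i + j).+1.
have li := catalan_sqr_ge i; have lj := catalan_sqr_ge j.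
have s0 : (0 : R) < (i + j).+2%:R by rewrite ltr0n.
rewrite -(@ler_pM2r _ ((i + j).+2%:R ^+ 3)) ?exprn_gt0 //.
apply: (le_trans up).
apply: (@le_trans _ _ (16 * (4 * i.+1%:R ^+ 3 * catalan i ^+ 2 * (4 * j.+1%:R ^+ 3 * catalan j ^+ 2)))).
  rewrite exprS exprD ler_pM2l //.
  by apply: ler_pM => //; rewrite exprn_ge0.
rewrite (_ : (i + j).+2%:R = i.+1%:R + j.+1%:R); last by rewrite -natrD addSn addnS.
set a := i.+1%:R; set b := j.+1%:R.
rewrite [leLHS](_ : _ = 4 * (catalan i * catalan j) ^+ 2 * (4 * a * b) ^+ 3); last by ring.
rewrite [leRHS](_ : _ = 4 * (catalan i * catalan j) ^+ 2 * ((a + b) ^+ 2) ^+ 3); last by ring.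
apply: ler_wpM2l; first by rewrite mulr_ge0 ?sqr_ge0.
have a0 : 0 <= a by exact: ler0n.
have b0 : 0 <= b by exact: ler0n.
apply: lerXn2r; rewrite ?nnegrE ?sqr_ge0 //; first by rewrite !mulr_ge0.
by have := sqr_ge0 (a - b); nra.
Qed.

End Catalan.

(** * Cycles split and joined by a transposition *)

Section CycleSplitting.
Variable X : finType.
Implicit Types (s : {perm X}) (x m i : X).

Lemma card_porbit_gt0 s x : (0 < #|porbit s x|)%N.
Proof. by rewrite lt0n card_porbit_neq0. Qed.

Lemma porbit_expg_inj s x a b : (a < #|porbit s x|)%N -> (b < #|porbit s x|)%N ->
  (s ^+ a)%g x = (s ^+ b)%g x -> a = b.
Proof.
move=> la lb e; have := uniq_traject_porbit s x.
move/(uniqP x)/(_ a b); rewrite !inE !size_traject !nth_traject //.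
by apply=> //; rewrite -!permX.
Qed.

Lemma porbit_expgP s x y : y \in porbit s x ->
  exists2 j, (j < #|porbit s x|)%N & y = (s ^+ j)%g x.
Proof.
rewrite porbit_traject => /trajectP[j lj ->]; exists j => //.
by rewrite permX.
Qed.

Lemma expg_card_porbit s x : (s ^+ #|porbit s x|)%g x = x.
Proof. by rewrite permX iter_porbit. Qed.

Lemma expgSp s n x : (s ^+ n.+1)%g x = s ((s ^+ n)%g x).
Proof. by rewrite expgSr permM. Qed.

Section Split.
Variables (s : {perm X}) (m : X) (j : nat).
Hypotheses (j_gt0 : (0 < j)%N) (j_lt : (j < #|porbit s m|)%N).
Let i := (s ^+ j)%g m.
Let t := (tperm i m * s)%g.

Lemma split_neq : i != m.
Proof.
apply/eqP => e; have := porbit_expg_inj j_lt (card_porbit_gt0 s m).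
by rewrite -/i e expg0 perm1 => /(_ erefl) j0; move: j_gt0; rewrite j0.
Qed.

(** Composition is from left to right, so t sends i to s m and then follows s, returning to i after
    j steps: neither i nor m occurs among s m, ..., s^(j - 1) m. *)
Lemma split_expg a : (0 < a <= j)%N -> (t ^+ a)%g i = (s ^+ a)%g m.
Proof.
elim: a => // -[_ _|a IH /andP[_ aj]]; first by rewrite !expg1 permM tpermL.
rewrite expgSp IH ?(ltnW aj) // [t _]permM tpermD -?expgSp //.
- apply/eqP => /(porbit_expg_inj j_lt (ltn_trans aj j_lt)) ja.
  by rewrite ja ltnn in aj.
- have e0 : m = (s ^+ 0)%g m by rewrite expg0 perm1.
  rewrite {1}e0; apply/eqP.
  by move/(porbit_expg_inj (card_porbit_gt0 s m) (ltn_trans aj j_lt)).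
Qed.

Lemma card_porbit_splitL : #|porbit t i| = j.
Proof.
have b0 := card_porbit_gt0 t i; apply/eqP; rewrite eqn_leq; apply/andP; split.
  rewrite leqNgt; apply/negP => jb.
  have := porbit_expg_inj jb b0; rewrite split_expg ?j_gt0 ?leqnn // expg0 perm1.
  by move/(_ erefl) => j0; move: j_gt0; rewrite j0.
rewrite leqNgt; apply/negP => bj.
have := expg_card_porbit t i; rewrite split_expg ?b0 ?(ltnW bj) //.
move/(porbit_expg_inj (ltn_trans bj j_lt) j_lt) => e.
by rewrite e ltnn in bj.
Qed.

Lemma split_notin : m \notin porbit t i.
Proof.
apply/negP => /porbit_expgP[[|a]]; rewrite card_porbit_splitL => aj.
  by rewrite expg0 perm1 => e; have := split_neq; rewrite -e eqxx.
rewrite split_expg ?(ltnW aj) // => e.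
have := porbit_expg_inj (ltn_trans aj j_lt) (card_porbit_gt0 s m).
by rewrite -e expg0 perm1 => /(_ erefl).
Qed.

Lemma split_outside x : x \notin porbit s m -> porbit t x = porbit s x.
Proof.
move=> xm.
have E a : (t ^+ a)%g x = (s ^+ a)%g x.
  elim: a => [|a IH]; first by rewrite !expg0.
  have out y : y \in porbit s m -> y != (s ^+ a)%g x.
    rewrite -eq_porbit_mem => /eqP ym; apply: contraNneq xm => e.
    by rewrite -eq_porbit_mem -(porbit_perm s a x) -e ym.
  by rewrite !expgSp IH [t _]permM tpermD // eq_sym eq_sym out ?mem_porbit ?porbit_id.
by apply/setP => y; apply/porbitP/porbitP => -[a ->]; exists a; rewrite E.
Qed.

Lemma split_inside x : x \in porbit s m -> porbit t x \subset porbit s m.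
Proof.
move=> xm; apply/subsetP => y /porbitP[a ->]; elim: a => [|a IH].
  by rewrite expg0 perm1.
rewrite expgSp [t _]permM; set z := tperm _ _ _.
have zm : z \in porbit s m by rewrite /z; case: tpermP => // _; rewrite ?mem_porbit ?porbit_id.
by move: zm; rewrite -!eq_porbit_mem => /eqP <-; rewrite -(porbit_perm s 1 z) expg1.
Qed.

End Split.

(** The same transposition seen from i = s^j m, from which m is reached after the remaining steps of
    the cycle. What is known of the half containing i thus transfers to the half containing m. *)
Lemma split_tpermC s m j : (j < #|porbit s m|)%N ->
  (tperm ((s ^+ j)%g m) m * s = tperm ((s ^+ (#|porbit s m| - j))%g ((s ^+ j)%g m)) ((s ^+ j)%g m) * s)%g.
Proof.
by move=> jl; rewrite tpermC -permM -expgD subnKC ?(ltnW jl) // expg_card_porbit.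
Qed.

Lemma card_porbit_splitR s m j : (0 < j)%N -> (j < #|porbit s m|)%N ->
  #|porbit (tperm ((s ^+ j)%g m) m * s)%g m| = (#|porbit s m| - j)%N.
Proof.
move=> j0 jl; rewrite split_tpermC //.
have := @card_porbit_splitL s ((s ^+ j)%g m) (#|porbit s m| - j).
rewrite porbit_perm subn_gt0 jl => /(_ isT); rewrite -permM -expgD subnKC ?(ltnW jl) //.
by rewrite expg_card_porbit => -> //; rewrite ltn_subrL j0 (leq_ltn_trans _ jl).
Qed.

(** Both new cycles lie in the old one and are disjoint, and their cardinals j and #|porbit s m| - j
    add up to its cardinal. *)
Lemma split_cover s m j : (0 < j)%N -> (j < #|porbit s m|)%N ->
  let t := (tperm ((s ^+ j)%g m) m * s)%g in
  porbit s m = porbit t ((s ^+ j)%g m) :|: porbit t m.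
Proof.
move=> j0 jl t; apply/esym/eqP; rewrite eqEcard subUset !split_inside ?porbit_id ?mem_porbit //=.
have dis : [disjoint porbit t ((s ^+ j)%g m) & porbit t m].
  rewrite -setI_eq0; apply/eqP/setP => x; rewrite !inE; apply/andP => -[].
  rewrite -!eq_porbit_mem => /eqP -> /eqP e.
  by have := split_notin j0 jl; rewrite -/t -eq_porbit_mem e eqxx.
rewrite cardsU (disjoint_setI0 dis) cards0 subn0.
by rewrite card_porbit_splitL // card_porbit_splitR // subnKC // ltnW.
Qed.

Lemma split_porbits s m j : (0 < j)%N -> (j < #|porbit s m|)%N ->
  let t := (tperm ((s ^+ j)%g m) m * s)%g in
  porbits t :\ porbit t ((s ^+ j)%g m) :\ porbit t m = porbits s :\ porbit s m.
Proof.
move=> j0 jl t; have cov := split_cover j0 jl.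
apply/setP => c; rewrite !inE; apply/and3P/andP => [[cm ci /imsetP[x _ cx]]|[cm /imsetP[x _ cx]]].
  have xm : x \notin porbit s m.
    by rewrite cov inE negb_or -!eq_porbit_mem -cx ci cm.
  split; last by rewrite cx split_outside // imset_f.
  by rewrite cx split_outside // eq_porbit_mem.
have xm : x \notin porbit s m by rewrite -eq_porbit_mem -cx.
have := xm; rewrite cov inE negb_or -!eq_porbit_mem split_outside // -cx => /andP[-> ->].
by split => //; rewrite cx -(split_outside j xm) imset_f.
Qed.

(** Multiplying by (i m) lowers the number of cycles here; multiplying once more must restore it,
    which requires i and m to share a cycle. *)
Lemma join_in s m i : i \notin porbit s m -> i \in porbit (tperm i m * s)%g m.
Proof.
move=> im; rewrite porbit_sym.
have := porbits_mul_tperm (tperm i m * s)%g i m; have := porbits_mul_tperm s i m.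
have -> : i != m by apply: contraNneq im => ->; exact: porbit_id.
rewrite /= mulgA tperm2 mul1g im porbit_sym; case: (m \in _) => //=; lia.
Qed.

End CycleSplitting.

(** * Length of a permutation and transpositions *)

Section PermLength.
Variable X : finType.
Implicit Types (s : {perm X}) (x m i : X).

Lemma leq_porbits s : (#|porbits s| <= #|X|)%N.
Proof. exact: leq_imset_card. Qed.

Lemma perm_length_split s m i : i != m -> i \in porbit s m ->
  perm_length s = (perm_length (tperm i m * s)%g).+1.
Proof.
move=> im ism; have := porbits_mul_tperm s i m; rewrite /= im ism /perm_length.
rewrite /= addn0 addn1 => e.
by have := leq_porbits (tperm i m * s)%g; rewrite e subnS => h; rewrite prednK // subn_gt0.
Qed.

Lemma perm_length_join s m i : i \notin porbit s m ->
  perm_length (tperm i m * s)%g = (perm_length s).+1.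
Proof.
move=> ism; rewrite (@perm_length_split _ m i) ?join_in //; last first.
  by apply: contraNneq ism => ->; exact: porbit_id.
by rewrite mulgA tperm2 mul1g.
Qed.

(** The points outside D are fixed, so together with m they lie in pairwise distinct cycles. This
    keeps the exponents #|D| + |s| within the range K of [growth]. *)
Lemma perm_length_on s (D : {set X}) m :
  perm_on D s -> m \in D -> (perm_length s <= #|D :\ m|)%N.
Proof.
move=> sD mD; rewrite /perm_length leq_subLR addnC -leq_subLR.
have <- : #|~: (D :\ m)| = (#|X| - #|D :\ m|)%N by rewrite cardsCs setCK.
have /subset_leq_card : porbit s @: (~: (D :\ m)) \subset porbits s.
  by apply/subsetP => c /imsetP[x _ ->]; exact: imset_f.
have fixed x y : x \notin D -> y \in porbit s x -> y = x.
  move=> xD /porbitP[a ->]; elim: a => [|a IH]; first by rewrite expg0 perm1.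
  by rewrite expgSr permM IH (out_perm sD).
rewrite card_in_imset // => x y; rewrite !inE !negb_and !negbK => xD yD /eqP.
rewrite eq_porbit_mem; case/orP: yD => [/eqP ->|yD]; last exact: fixed.
case/orP: xD => [/eqP ->//|xD]; rewrite porbit_sym => mx.
by rewrite (fixed _ _ xD mx).
Qed.

Lemma perm_length1 : perm_length (1%g : {perm X}) = 0%N.
Proof.
rewrite /perm_length card_imset ?subnn // => x y /eqP.
rewrite eq_porbit_mem => /porbitP[a ->]; by rewrite expg1n perm1.
Qed.

End PermLength.

(** * Catalan weights of permutations *)

Section CycleWeight.
Variables (R : realFieldType) (X : finType).
Implicit Types (s : {perm X}) (x m i : X).

(* A cycle of length a contributes C_(a - 1): the weight of s is the number of monotone
   factorizations of s into perm_length s transpositions. *)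
Definition cycle_weight s : R := \prod_(c in porbits s) catalan R #|c|.-1.

Lemma cycle_weight_gt0 s : 0 < cycle_weight s.
Proof. by apply: prodr_gt0 => c _; exact: catalan_gt0. Qed.

Lemma cycle_weight_ge0 s : 0 <= cycle_weight s.
Proof. exact/ltW/cycle_weight_gt0. Qed.

Lemma partition_porbits s : partition (porbits s) [set: X].
Proof.
have -> : porbits s = preim_partition (porbit s) [set: X].
  apply/setP => c; apply/imsetP/imsetP => -[x _ ->]; exists x; rewrite ?inE //.
    by apply/setP => y; rewrite !inE eq_porbit_mem porbit_sym.
  by apply/setP => y; rewrite !inE eq_porbit_mem porbit_sym.
exact: preim_partitionP.
Qed.

(** The numbers a - 1, over the cycle lengths a, add up to the length of s. This is the source of
    the factor 4^|p q^-1| in the final bound. *)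
Lemma cycle_weight_le s : cycle_weight s <= 4 ^+ perm_length s.
Proof.
have cn0 c : c \in porbits s -> (0 < #|c|)%N by case/imsetP => x _ ->; exact: card_porbit_gt0.
have -> : perm_length s = (\sum_(c in porbits s) #|c|.-1)%N.
  rewrite /perm_length -cardsT (card_partition (partition_porbits s)) -sum1_card -sumnB //.
    by apply: eq_bigr => c _; rewrite subn1.
rewrite expr_sum; apply: ler_prod => c _.
by rewrite ltW ?catalan_gt0 ?catalan_le.
Qed.

Lemma cycle_weight_at s m : cycle_weight s =
  catalan R #|porbit s m|.-1 * \prod_(c in porbits s :\ porbit s m) catalan R #|c|.-1.
Proof. by rewrite /cycle_weight (big_setD1 (porbit s m)) // imset_f. Qed.

Lemma cycle_weight_cut s m j : (0 < j)%N -> (j < #|porbit s m|)%N ->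
  cycle_weight (tperm ((s ^+ j)%g m) m * s)%g =
  catalan R j.-1 * catalan R (#|porbit s m| - j).-1 *
  \prod_(c in porbits s :\ porbit s m) catalan R #|c|.-1.
Proof.
move=> j0 jl; set t := (_ * _)%g; set i := (s ^+ j)%g m.
rewrite (cycle_weight_at _ i) card_porbit_splitL // -mulrA; congr (_ * _).
rewrite (big_setD1 (porbit t m)) /=; last first.
  by rewrite !inE imset_f // andbT eq_porbit_mem split_notin.
by rewrite card_porbit_splitR // split_porbits.
Qed.

(** Writing i = s^(j + 1) m, the cycle of length a splits into lengths j + 1 and a - j - 1, and the
    sum of the C_j C_(a - 2 - j) is C_(a - 1). *)
Lemma sum_cycle_weight_split s m : s m != m ->
  \sum_(i in porbit s m :\ m) cycle_weight (tperm i m * s)%g = cycle_weight s.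
Proof.
move=> sm; set a := #|porbit s m|.
have a1 : (1 < a)%N.
  rewrite ltnNge; apply/negP => a1; have : a == 1%N by rewrite eqn_leq a1 card_porbit_gt0.
  case/cards1P => x e; have := mem_porbit s 1 m; have := porbit_id s m.
  by rewrite e !inE expg1 => /eqP <- /eqP smx; rewrite smx eqxx in sm.
have -> : porbit s m :\ m = [set (s ^+ j.+1)%g m | j : 'I_a.-1].
  apply/setP => x; rewrite !inE; apply/andP/imsetP => [[xm /porbit_expgP[[|j] jl e]]|[j _ ->]].
  - by move: xm; rewrite e expg0 perm1 eqxx.
  - have jl' : (j < a.-1)%N by rewrite -/a in jl; lia.
    by exists (Ordinal jl').
  - by rewrite mem_porbit split_neq // -/a; have := ltn_ord j; lia.
rewrite big_imset /=; last first.
  move=> j k _ _ /porbit_expg_inj e; apply/val_inj/succn_inj/e; rewrite -/a.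
    by have := ltn_ord j; lia.
  by have := ltn_ord k; lia.
under eq_bigr => j _.
  rewrite cycle_weight_cut -/a //; last by have := ltn_ord j; lia.
  over.
rewrite -mulr_suml (cycle_weight_at s m) -/a; congr (_ * _).
have -> : a.-1 = (a.-2).+1 by lia.
rewrite -catalan_conv; apply: eq_bigr => j _ /=; congr (_ * catalan _ _); lia.
Qed.

Lemma cycle_weight_join s m i : i \notin porbit s m ->
  cycle_weight (tperm i m * s)%g ^+ 2 <= 4 * #|X|%:R ^+ 3 * cycle_weight s ^+ 2.
Proof.
move=> im; set t := (_ * _)%g.
have [[|j] jl ij] := porbit_expgP (join_in im); rewrite -/t in jl ij.
  by case/negP: im; rewrite ij expg0 perm1 porbit_id.
(* Joining is undone by the same transposition, so s is a split of t and [cycle_weight_cut] computes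
   its weight. *)
have -> : s = (tperm ((t ^+ j.+1)%g m) m * t)%g by rewrite -ij /t mulgA tperm2 mul1g.
rewrite cycle_weight_cut // (cycle_weight_at t m).
set V := \prod_(c in _) _; set a := #|porbit t m|.
rewrite exprMn [in leRHS]exprMn [leRHS]mulrA ler_wpM2r ?sqr_ge0 //=.
have e : a.-1 = (j + (a - j.+1).-1).+1 by rewrite -/a in jl; lia.
rewrite {1}e; apply: le_trans (catalan_join R _ _) _.
rewrite ler_wpM2r ?sqr_ge0 // ler_pM2l // lerXn2r ?nnegrE ?ler0n // ler_nat -e.
by rewrite prednK ?card_porbit_gt0 ?max_card.
Qed.

Lemma cycle_weight1 : cycle_weight 1 = 1.
Proof.
apply: big1 => c /imsetP[x _ ->]; suff -> : #|porbit 1 x| = 1%N by rewrite catalan0.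
by apply/eqP/cards1P; exists x; rewrite porbit.unlock cycle1 imset_set1 /aperm perm1.
Qed.

End CycleWeight.

(** * The centered recursion *)

(** Toggling a fixed element of Z is a sign-reversing involution on the subsets of Z. *)
Lemma sum_sign_subset (R : numDomainType) (I : finType) (Z : {set I}) :
  \sum_(B : {set I} | B \subset Z) (-1) ^+ #|B| = (Z == set0)%:R :> R.
Proof.
case: (set_0Vmem Z) => [->|[z zZ]].
  rewrite eqxx (eq_bigl (pred1 set0)) ?big_pred1_eq ?cards0 // => B.
  by rewrite subset0.
have -> : (Z == set0) = false by apply/negbTE/set0Pn; exists z.
pose f (B : {set I}) := if z \in B then B :\ z else z |: B.
have fK : involutive f.
  move=> B; rewrite /f; case: (boolP (z \in B)) => zB.
    by rewrite setD11 setD1K.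
  by rewrite setU11 setU1K.
have fZ B : (f B \subset Z) = (B \subset Z).
  rewrite /f; case: (boolP (z \in B)) => zB; last by rewrite subUset sub1set zZ.
  by rewrite -[in RHS](setD1K zB) subUset sub1set zZ.
have fS B : (-1) ^+ #|f B| = - (-1) ^+ #|B| :> R.
  rewrite /f; case: (boolP (z \in B)) => zB; last by rewrite cardsU1 zB exprS mulN1r.
  by rewrite (cardsD1 z B) zB exprS mulN1r opprK.
set S := \sum_(_ | _) _; suff : S = - S by move/eqP; rewrite -addr_eq0 -mulr2n mulrn_eq0 => /eqP.
rewrite {1}/S (reindex_inj (inv_inj fK)) /= -sumrN; apply: eq_big => B; first exact: fZ.
by rewrite fS.
Qed.

Section Centered.
Variables (R : realFieldType) (X : finType) (nu : R) (F : {set X} -> {perm X} -> R).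
Hypothesis F_local : forall (D : {set X}) (s t : {perm X}), {in D, s =1 t} -> F D s = F D t.
Hypothesis F_nil : forall s, F set0 s = 1.
Hypothesis F_rec : forall (D : {set X}) (s : {perm X}) (m : X),
  (forall x, x \in D -> s x \in D) -> m \in D ->
  nu * F D s + \sum_(i in D :\ m) F D (tperm i m * s)%g = (s m == m)%:R * F (D :\ m) s.

(** Blocks are encoded as fibres of a coloring: D can then lose points without changing the blocks,
    and an empty fibre contributes 1 by [F_nil]. *)
Definition color_product (C : finType) (f : X -> C) (D : {set X}) (s : {perm X}) : R :=
  [forall x, f (s x) == f x]%:R * \prod_(u : C) F (D :&: [set x | f x == u]) s.

(** A transposition within the color of m does not affect color preservation and is trivial on the
    other fibres. Only the factor of the color of m moves, and it obeys [F_rec]. *)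
Lemma color_product_rec (C : finType) (f : X -> C) (D : {set X}) (s : {perm X}) m :
  perm_on D s -> m \in D ->
  nu * color_product f D s
    + \sum_(i in D :\ m | f i == f m) color_product f D (tperm i m * s)%g
  = (s m == m)%:R * color_product f (D :\ m) s.
Proof.
move=> sD mD; rewrite /color_product.
have stab i : f i == f m ->
    [forall x, f ((tperm i m * s)%g x) == f x] = [forall x, f (s x) == f x].
  move=> /eqP im; have ft x : f (tperm i m x) = f x by case: tpermP => // ->.
  apply/forallP/forallP => h x; last by rewrite permM (eqP (h _)) ft.
  by have := h (tperm i m x); rewrite permM tpermK ft.
under [X in _ + X]eq_bigr => i iD do rewrite (stab i (proj2 (andP iD))).
case: forallP => [fs|_]; last first.
  by rewrite /= !mulr0n !mul0r !mulr0 big1 ?addr0 // => i _; rewrite mul0r.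
rewrite !mul1r; under [X in _ + X]eq_bigr => i _ do rewrite mul1r.
pose V := \prod_(u | u != f m) F (D :&: [set x | f x == u]) s.
rewrite (bigD1 (f m)) //= -/V.
have -> : \prod_u F ((D :\ m) :&: [set x | f x == u]) s =
    F ((D :&: [set x | f x == f m]) :\ m) s * V.
  rewrite (bigD1 (f m)) //=; congr (_ * _).
    by congr (F _ s); apply/setP => x; rewrite !inE andbA.
  apply: eq_bigr => u um; congr (F _ s); apply/setP => x; rewrite !inE.
  by case: (eqVneq x m) => [->|//]; rewrite eq_sym (negbTE um) !andbF.
have -> : \sum_(i in D :\ m | f i == f m)
      \prod_u F (D :&: [set x | f x == u]) (tperm i m * s)%g =
    (\sum_(i in (D :&: [set x | f x == f m]) :\ m)
      F (D :&: [set x | f x == f m]) (tperm i m * s)%g) * V.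
  rewrite mulr_suml; apply: eq_big => [i|i /andP[_ im]]; first by rewrite !inE andbA.
  rewrite (bigD1 (f m)) //=; congr (_ * _); apply: eq_bigr => u um.
  apply: F_local => x; rewrite !inE => /andP[_ /eqP xu]; rewrite permM tpermD //.
    by apply: contraNneq um => e; rewrite -xu -e (eqP im).
  by apply: contraNneq um => e; rewrite -xu -e.
rewrite !mulrA -mulrDl F_rec ?inE ?mD ?eqxx // => x; rewrite !inE.
by rewrite (eqP (fs x)) (perm_closed _ sD).
Qed.

Variables (I : finType) (c : X -> I).

(* B is the complement of the set A of merged blocks. *)
Definition keep_colors (B : {set I}) (x : X) : option I := if c x \in B then Some (c x) else None.

(** Indexing by the complement B of A makes the sign (-1)^#|B|. The range Z is a parameter because
    it shrinks along the recursion. *)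
Definition centered_sum (Z : {set I}) (D : {set X}) (s : {perm X}) : R :=
  \sum_(B : {set I} | B \subset Z) (-1) ^+ #|B| * color_product (keep_colors B) D s.

(* The colors of Z which remain to be crossed once the transposition (i m) has been used. *)
Definition uncrossed (Z : {set I}) (i m : X) : {set I} :=
  if c i == c m then Z else Z :\ c i :\ c m.

(** Points of distinct colors become equal in color only when both colors are merged, that is, when
    neither lies in B. *)
Lemma keep_colors_eq (B Z : {set I}) i m :
  (B \subset Z) && (keep_colors B i == keep_colors B m) = (B \subset uncrossed Z i m).
Proof.
rewrite /keep_colors /uncrossed; case: (eqVneq (c i) (c m)) => [->|im]; first by rewrite eqxx andbT.
rewrite !subsetD1 -andbA; congr (_ && _).
case: ifP => ci; case: ifP => cm //=; rewrite ?eqxx //.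
by rewrite /eq_op /= (negbTE im).
Qed.

(** After the sums over i and B are exchanged, the sets B for which i contributes are exactly the
    subsets of [uncrossed Z i m], by [keep_colors_eq]. *)
Lemma centered_sum_rec (Z : {set I}) (D : {set X}) (s : {perm X}) m :
  perm_on D s -> m \in D ->
  nu * centered_sum Z D s = (s m == m)%:R * centered_sum Z (D :\ m) s
    - \sum_(i in D :\ m) centered_sum (uncrossed Z i m) D (tperm i m * s)%g.
Proof.
move=> sD mD; rewrite /centered_sum.
have -> : \sum_(i in D :\ m) \sum_(B : {set I} | B \subset uncrossed Z i m)
      (-1) ^+ #|B| * color_product (keep_colors B) D (tperm i m * s)%g =
    \sum_(B : {set I} | B \subset Z) (-1) ^+ #|B| *
      \sum_(i in D :\ m | keep_colors B i == keep_colors B m)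
        color_product (keep_colors B) D (tperm i m * s)%g.
  under [RHS]eq_bigr do rewrite mulr_sumr.
  rewrite [RHS](exchange_big_dep [in D :\ m]) /=; last by move=> B i _ /andP[].
  by apply: eq_bigr => i iD; apply: eq_bigl => B; rewrite -keep_colors_eq iD.
rewrite !mulr_sumr -sumrB; apply: eq_bigr => B _.
by rewrite mulrCA [_%:R * _]mulrCA -mulrBr -(color_product_rec _ sD mD) addrK.
Qed.

Lemma centered_sum_nil (Z : {set I}) : centered_sum Z set0 1%g = (Z == set0)%:R.
Proof.
rewrite -sum_sign_subset; apply: eq_bigr => B _; rewrite /color_product.
have -> : [forall x, keep_colors B ((1%g : {perm X}) x) == keep_colors B x].
  by apply/forallP => x; rewrite perm1.
by rewrite mul1r big1 ?mulr1 // => u _; rewrite set0I F_nil.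
Qed.

(** Classes that are unions of cycles of s: splitting a cycle never crosses them, so only a join can
    remove them. *)
Definition stable_colors (Z : {set I}) (s : {perm X}) : {set I} :=
  [set z in Z | [forall x, (c (s x) == z) == (c x == z)]].

Lemma stable_colors_step (Z : {set I}) (s : {perm X}) i m z :
  z \in stable_colors Z s -> (c i == z) = (c m == z) ->
  z \in stable_colors (uncrossed Z i m) (tperm i m * s)%g.
Proof.
rewrite !inE => /andP[zZ /forallP zs] im; apply/andP; split.
  rewrite /uncrossed; case: (eqVneq (c i) (c m)) => // ne; rewrite !inE zZ andbT.
  apply/andP; split; apply: contraNneq ne => e.
    by move: im; rewrite e eqxx => /eqP ->.
  by move: im; rewrite e eqxx eq_sym => /esym/eqP ->.
by apply/forallP => x; rewrite permM (eqP (zs _)); case: tpermP => // ->; rewrite ?im.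
Qed.

Lemma stable_colors_split (Z : {set I}) (s : {perm X}) i m : i \in porbit s m ->
  (#|stable_colors Z s| <= #|stable_colors (uncrossed Z i m) (tperm i m * s)%g|)%N.
Proof.
move=> /porbitP[a ->]; apply/subset_leq_card/subsetP => z zs.
apply: stable_colors_step => //; move: zs; rewrite inE => /andP[_ /forallP zs].
elim: a => [|a IH]; first by rewrite expg0 perm1.
by rewrite expgSp (eqP (zs _)).
Qed.

(** Only the colors of i and m can be lost. *)
Lemma stable_colors_join (Z : {set I}) (s : {perm X}) i m :
  (#|stable_colors Z s| - 2 <= #|stable_colors (uncrossed Z i m) (tperm i m * s)%g|)%N.
Proof.
rewrite leq_subLR; set S := stable_colors (uncrossed _ _ _) _.
apply: (@leq_trans #|[set c i; c m] :|: S|); last first.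
  by rewrite cardsU (leq_trans (leq_subr _ _)) // leq_add2r cards2; case: (_ != _).
apply/subset_leq_card/subsetP => z zs; rewrite in_setU in_set2.
case: (eqVneq z (c i)) => //= zi; case: (eqVneq z (c m)) => //= zm.
apply: stable_colors_step => //.
by rewrite [c i == z]eq_sym [c m == z]eq_sym (negbTE zi) (negbTE zm).
Qed.

End Centered.

(** * The supersolution *)

Section Growth.
Variables (R : realFieldType) (z : R) (K : nat).
Hypotheses (z_ge0 : 0 <= z) (z2_le : z ^+ 2 <= 1 / 2).

(* With z = k^(7/4) / n, this absorbs the factor lost at each transposition that raises the
   length; such a step consumes at most two of the r colors still to be crossed. *)
Definition growth (l r : nat) : R :=
  if r is 0 then 1 + z ^+ 2 * (l%:R / K%:R) else z ^+ r * (l%:R / K%:R).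

Let z_le1 : z <= 1.
Proof. by rewrite -(@expr_le1 _ 2) //; apply: le_trans z2_le _; lra. Qed.

Let ratio_ge0 (l : nat) : 0 <= l%:R / K%:R :> R.
Proof. by rewrite divr_ge0 ?ler0n. Qed.

Let ratio_le1 (l : nat) : (l <= K)%N -> l%:R / K%:R <= 1 :> R.
Proof.
case: (posnP K) => [->|K0 lK]; first by rewrite invr0 mulr0.
by rewrite ler_pdivrMr ?ltr0n // mul1r ler_nat.
Qed.

Lemma growth_ge0 l r : 0 <= growth l r.
Proof. by case: r => [|r] /=; [apply: addr_ge0 => //|]; apply: mulr_ge0; rewrite ?exprn_ge0. Qed.

Lemma growth_le l r : (l <= K)%N -> growth l r <= z ^+ r * (1 + z ^+ 2).
Proof.
move=> /ratio_le1 lK; have zz := sqr_ge0 z; have l0 := ratio_ge0 l.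
case: r => [|r] /=; first by rewrite expr0 mul1r lerD2l ler_piMr.
by rewrite ler_wpM2l ?exprn_ge0 //; lra.
Qed.

Lemma growth_antitone l r r' : (l <= K)%N -> (r <= r')%N -> growth l r' <= growth l r.
Proof.
move=> lK; case: r r' => [|r] [|r'] //= rr'.
  apply: (@le_trans _ _ 1); last by rewrite lerDl mulr_ge0 ?ratio_ge0 ?exprn_ge0.
  by rewrite mulr_ile1 ?exprn_ge0 ?exprn_ile1 ?ratio_le1.
by rewrite ler_wpM2r // ler_wiXn2l.
Qed.

(** The increment of [growth] in l is z^2/K, z/K or z^r/K for r = 0, r = 1 or r >= 2, hence at least
    z^(r - 2) z^2/K with truncated subtraction. This pays for the joins, whose factor is at most
    z^(r - 2) (1 + z^2). *)
Lemma growth_step (d : R) l r r' : (0 < K)%N -> (l.+2 <= K)%N -> (r - 2 <= r')%N ->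
  0 <= d -> K%:R * d * (1 + z ^+ 2) <= z ^+ 2 ->
  growth l r + d * growth l.+2 r' <= growth l.+1 r.
Proof.
move=> K0 lK rr' d0 dK; have K0' : (0 : R) < K%:R by rewrite ltr0n.
have up : d * growth l.+2 r' <= d * (z ^+ (r - 2) * (1 + z ^+ 2)).
  rewrite ler_wpM2l // (le_trans (growth_le _ lK)) // ler_wpM2r ?ler_wiXn2l //.
  by have := sqr_ge0 z; lra.
have {dK}dK : d * (1 + z ^+ 2) <= z ^+ 2 / K%:R by rewrite ler_pdivlMr //; lra.
have e : l.+1%:R / K%:R = l%:R / K%:R + K%:R^-1 :> R by rewrite -natr1 mulrDl mul1r.
apply: (le_trans (lerD (lexx _) up)).
case: r {up rr'} => [|[|r]] /=; rewrite e ?subn2 /= ?expr0 ?mul1r.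
- by lra.
- have : z ^+ 2 / K%:R <= z / K%:R.
    by rewrite ler_wpM2r ?invr_ge0 ?ler0n // expr2 ler_piMl.
  by rewrite expr1; lra.
- rewrite (_ : d * _ = z ^+ r * (d * (1 + z ^+ 2))); last by ring.
  rewrite [leRHS]mulrDr lerD2l (_ : z ^+ r.+2 * _ = z ^+ r * (z ^+ 2 / K%:R)); last by rewrite -addn2 exprD mulrA.
  by rewrite ler_wpM2l ?exprn_ge0.
Qed.

End Growth.

(** * Comparison of the centered sum with its majorant *)

Section Bound.
Variables (R : realFieldType) (X : finType) (nu : R) (F : {set X} -> {perm X} -> R).
Hypothesis F_local : forall (D : {set X}) (s t : {perm X}), {in D, s =1 t} -> F D s = F D t.
Hypothesis F_nil : forall s, F set0 s = 1.
Hypothesis F_rec : forall (D : {set X}) (s : {perm X}) (m : X),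
  (forall x, x \in D -> s x \in D) -> m \in D ->
  nu * F D s + \sum_(i in D :\ m) F D (tperm i m * s)%g = (s m == m)%:R * F (D :\ m) s.
Variables (I : finType) (c : X -> I) (z J : R) (K : nat).
Hypotheses (nu_gt0 : 0 < nu) (nu_ge : #|X|%:R <= nu).
Hypotheses (z_ge0 : 0 <= z) (z2_le : z ^+ 2 <= 1 / 2) (K_ge : (#|X|.*2 <= K)%N).
Hypotheses (J_ge0 : 0 <= J) (J_ge : 4 * #|X|%:R ^+ 3 <= J ^+ 2).
Hypothesis zJ : #|X|%:R * J * K%:R * (1 + z ^+ 2) <= z ^+ 2 * nu ^+ 2.

Let G := centered_sum F c.
Implicit Types (Z : {set I}) (D : {set X}) (s : {perm X}) (i m : X).

Definition majorant (Z : {set I}) (D : {set X}) (s : {perm X}) : R :=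
  nu ^- (#|D| + perm_length s) * cycle_weight R s *
  growth z K (#|D| + perm_length s) #|stable_colors c Z s|.

Lemma perm_on_join D s i m : perm_on D s -> i \in D -> m \in D ->
  perm_on D (tperm i m * s)%g.
Proof.
move=> sD iD mD; apply: perm_onM => //; apply: subset_trans (tperm_on i m) _.
by rewrite subUset !sub1set iD.
Qed.

Lemma cycle_weight_join_le s i m : i \notin porbit s m ->
  cycle_weight R (tperm i m * s)%g <= J * cycle_weight R s.
Proof.
move=> ism; rewrite -(@ler_pXn2r _ 2) ?nnegrE ?mulr_ge0 ?cycle_weight_ge0 // (le_trans (cycle_weight_join R ism)) //.
by rewrite exprMn ler_wpM2r ?sqr_ge0.
Qed.

Lemma majorant_join Z D s i m : perm_on D s -> i \in D -> m \in D ->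
    i \notin porbit s m ->
  majorant (uncrossed c Z i m) D (tperm i m * s)%g <=
  nu ^- (#|D| + perm_length s) * cycle_weight R s * (nu^-1 * J) *
  growth z K (#|D| + perm_length s).+1 (#|stable_colors c Z s| - 2).
Proof.
move=> sD iD mD ism; rewrite /majorant perm_length_join // addnS.
have lK : ((#|D| + perm_length s).+1 <= K)%N.
  have := perm_length_on sD mD; have := max_card D; rewrite (cardsD1 m D) mD; move: K_ge; clear; lia.
have nu0 : 0 <= nu by exact: ltW.
apply: ler_pM; rewrite ?growth_ge0 ?mulr_ge0 ?invr_ge0 ?exprn_ge0 ?cycle_weight_ge0 //.
  rewrite exprS invfM [_^-1 * _]mulrC -!mulrA ler_wpM2l ?invr_ge0 ?exprn_ge0 //.
  rewrite mulrCA ler_wpM2l ?invr_ge0 // mulrC.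
  exact: cycle_weight_join_le.
by apply: growth_antitone => //; exact: stable_colors_join.
Qed.

(** If m is fixed, no cycle through it can be split and the first term carries the whole weight.
    Otherwise this is the Catalan recursion on the cycle of m, which stays in D. *)
Lemma sum_cycle_weight_split_le D s m : perm_on D s -> m \in D ->
  (s m == m)%:R * cycle_weight R s
    + \sum_(i in D :\ m | i \in porbit s m) cycle_weight R (tperm i m * s)%g
  = cycle_weight R s.
Proof.
move=> sD mD; case: (eqVneq (s m) m) => sm.
  rewrite mul1r big_pred0 ?addr0 // => i; rewrite !inE; apply/negP => /andP[/andP[im _]].
  case/porbitP => a e; case/eqP: im; rewrite e; elim: a {e} => [|a IH].
    by rewrite expg0 perm1.
  by rewrite expgSp IH.
rewrite mul0r add0r -(sum_cycle_weight_split R sm); apply: eq_bigl => i.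
rewrite !inE -andbA; congr (_ && _); case: (boolP (i \in porbit s m)) => [|_]; last by rewrite andbF.
case/porbitP => a ->; rewrite andbT; elim: a => [|a IH]; first by rewrite expg0 perm1.
by rewrite expgSp perm_closed.
Qed.

(** Supersolution property. Removing m or splitting a cycle gives the exponent a, and by the Catalan
    recursion these weights add up to W; joins give a + 2, and [growth_step] absorbs them. *)
Lemma majorant_rec Z D s m : perm_on D s -> m \in D ->
  (s m == m)%:R * majorant Z (D :\ m) s
    + \sum_(i in D :\ m) majorant (uncrossed c Z i m) D (tperm i m * s)%g
  <= nu * majorant Z D s.
Proof.
move=> sD mD; set a := (#|D :\ m| + perm_length s)%N.
have aD : (#|D| + perm_length s)%N = a.+1 by rewrite (cardsD1 m) mD.
have aK : (a.+2 <= K)%N.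
  have := perm_length_on sD mD; have := max_card D; rewrite /a (cardsD1 m D) mD; move: K_ge; clear; lia.
set W := cycle_weight R s; set r := #|stable_colors c Z s|.
have W0 : 0 <= W by exact: cycle_weight_ge0.
have na0 : 0 <= nu ^- a by rewrite invr_ge0 exprn_ge0 // ltW.
(* Total cost of the joins: at most #|X| of them, each with a factor J in weight and nu^-2 from the
   exponent. *)
set d := #|X|%:R * J / nu ^+ 2.
have step : growth z K a r + d * growth z K a.+2 (r - 2) <= growth z K a.+1 r.
  apply: growth_step => //; first exact: leq_trans aK.
    by rewrite !mulr_ge0 ?invr_ge0 ?exprn_ge0 ?ler0n // ltW.
  rewrite /d [leLHS](_ : _ = #|X|%:R * J * K%:R * (1 + z ^+ 2) / nu ^+ 2); last first.
    by move: (#|X|%:R : R) (K%:R : R) => x y; field; rewrite gt_eqF.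
  by rewrite ler_pdivrMr ?exprn_gt0.
rewrite [leRHS](_ : _ = nu ^- a * W * growth z K a.+1 r); last first.
  by rewrite /majorant aD exprS invfM !mulrA divff ?mul1r // gt_eqF.
apply: le_trans (ler_wpM2l (mulr_ge0 na0 W0) step).
rewrite (bigID [in porbit s m]) /= addrA mulrDr; apply: lerD.
  rewrite -[X in nu ^- a * X](sum_cycle_weight_split_le sD mD) mulrDr mulrDl; apply: lerD.
    case: (eqVneq (s m) m) => sm; last by rewrite !mul0r mulr0 mul0r.
    by rewrite !mul1r /majorant -/a ler_wpM2l ?mulr_ge0 // growth_antitone // ltnW // ltnW.
  rewrite mulr_sumr mulr_suml; apply: ler_sum => i /andP[]; rewrite !inE => /andP[im iD] ism.
  have la : (#|D| + perm_length (tperm i m * s)%g)%N = a.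
    by apply: succn_inj; rewrite -addnS -(perm_length_split im ism).
  rewrite /majorant la ler_wpM2l ?mulr_ge0 ?cycle_weight_ge0 //.
  by apply: growth_antitone => //; [exact/ltnW/ltnW|exact: stable_colors_split].
apply: (@le_trans _ _ (\sum_(i in D :\ m | i \notin porbit s m)
    (nu ^- a.+1 * W * (nu^-1 * J) * growth z K a.+2 (r - 2)))).
  apply: ler_sum => i /andP[]; rewrite !inE => /andP[im iD] ism.
  by rewrite -aD; exact: majorant_join.
rewrite sumr_const -mulr_natl.
rewrite (_ : nu ^- a * W * _ = #|X|%:R * (nu ^- a.+1 * W * (nu^-1 * J) * growth z K a.+2 (r - 2))); last first.
  rewrite /d [nu ^+ a.+1]exprS; move: (#|X|%:R : R) (nu ^+ a) (exprn_gt0 a nu_gt0) (growth _ _ _ _) => x y y0 g.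
  by rewrite expr2 !invfM; ring.
apply: ler_wpM2r; last by rewrite ler_nat max_card.
by rewrite !mulr_ge0 ?invr_ge0 ?exprn_ge0 ?growth_ge0 // ltW.
Qed.

(* Maximum principle: a positive maximum e of |G| - majorant over the permutations supported
   in D would satisfy nu * e <= (#|D| - 1) * e. *)
Lemma centered_sum_le_majorant Z D s : perm_on D s -> `|G Z D s| <= majorant Z D s.
Proof.
move: {2}#|D| (erefl #|D|) => d; elim: d D Z s => [|d IH] D Z s dD.
  move/eqP: dD; rewrite cards_eq0 => /eqP -> s0.
  have -> : s = 1%g by apply: (perm_on_id s0); rewrite cards0.
  rewrite /G (centered_sum_nil F_nil) /majorant cards0 cycle_weight1 perm_length1 mulr1.
  have -> : stable_colors c Z 1%g = Z.
    apply/setP => u; rewrite !inE (_ : [forall x, _]) ?andbT //.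
    by apply/forallP => x; rewrite perm1.
  (* At l = 0 the growth factor is 1 if no color is left and 0 otherwise, which matches the
     alternating sum over subsets of Z. *)
  rewrite expr0 invr1 mul1r /growth mul0r !mulr0 addr0 -cards_eq0.
  by case: #|Z| => [|r] /=; rewrite ?normr1 ?normr0.
have [m mD] : exists m, m \in D by apply/set0Pn; rewrite -card_gt0 dD.
(* The maximum is taken over Z as well, since the recursion changes Z; D stays fixed except in the
   term for D minus m, left to the induction. *)
pose e (x : {set I} * {perm X}) := `|G x.1 D x.2| - majorant x.1 D x.2.
pose P (x : {set I} * {perm X}) := perm_on D x.2.
have P0 : P (Z, 1%g) by exact: perm_on1.
case: (arg_maxP e P0) => -[Z0 s0] s0D emax.
have Dm : #|D :\ m| = d by move: dD; rewrite (cardsD1 m) mD => -[].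
have le0 : nu * e (Z0, s0) <= d%:R * e (Z0, s0).
  rewrite -Dm mulr_natl -sumr_const.
  rewrite {1}/e mulrBr /= -(gtr0_norm nu_gt0) -normrM (gtr0_norm nu_gt0).
  rewrite /G (centered_sum_rec F_local F_rec c _ s0D mD).
  rewrite lerBlDr (le_trans _ (lerD (lexx _) (majorant_rec Z0 s0D mD))) //.
  apply: (le_trans (ler_normB _ _)); rewrite addrCA lerD //.
    case: eqP => [sm|_]; last by rewrite !mul0r normr0.
    rewrite !mul1r; apply: IH => //; apply/subsetP => x; rewrite !inE => sx.
    by rewrite (subsetP s0D) // andbT; apply: contraNneq sx => ->; rewrite sm.
  apply: (le_trans (ler_norm_sum _ _ _)); rewrite -big_split /=.
  apply: ler_sum => i; rewrite !inE => /andP[_ iD].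
  have := emax (uncrossed c Z0 i m, (tperm i m * s0)%g) (perm_on_join s0D iD mD).
  by rewrite {1}/e /= lerBlDr.
have e_le0 : e (Z0, s0) <= 0.
  rewrite leNgt; apply/negP => e_gt0; move: le0; rewrite ler_pM2r // => nud.
  have dX : (d < #|X|)%N by rewrite -dD max_card.
  by have := le_trans nu_ge nud; rewrite ler_nat leqNgt dX.
move=> sD; have := emax (Z, s) sD; rewrite {1}/e /= => h.
by rewrite -subr_le0 (le_trans h).
Qed.

End Bound.

(** * Pairings *)

Section Partner.
Variables (k : nat) (eps : {ffun 'I_k -> bool}) (p : {set {set 'I_k}}).
Hypothesis p_pairing : p \in pairings eps.

Lemma pairing_partition : partition p [set: 'I_k].
Proof. by move: p_pairing; rewrite inE => /andP[]. Qed.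

Lemma pairing_trivIset : trivIset p.
Proof. by case/and3P: pairing_partition. Qed.

Lemma pairing_cover i : i \in cover p.
Proof. by rewrite (cover_partition pairing_partition) inE. Qed.

Lemma pairing_pblock i : pblock p i \in p.
Proof. by rewrite pblock_mem ?pairing_cover. Qed.

Lemma partnerP i : pblock p i = [set i; partner p i] /\ eps (partner p i) = ~~ eps i.
Proof.
rewrite /partner; have ip : i \in pblock p i by rewrite mem_pblock pairing_cover.
move: (pairing_pblock i) p_pairing ip; rewrite inE => cp /andP[_ /forall_inP /(_ _ cp)].
case/existsP => a /existsP[b /and3P[ea eb /eqP ->]]; rewrite !inE => iab.
have ab : a != b by apply: contraNneq eb => <-.
case: pickP => [j|/(_ (if i == a then b else a))]; rewrite /= !inE.
  case/orP: iab => /eqP ->; case/andP=> ji /orP[]/eqP jE; rewrite jE ?eqxx // in ji *.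
    by rewrite ea (negbTE eb).
  by rewrite setUC ea eb.
by case/orP: iab => /eqP ->; rewrite ?eqxx ?[b == a]eq_sym ?(negbTE ab) /= ?eqxx ?orbT // ?[b == a]eq_sym (negbTE ab).
Qed.

Lemma pblockE i : pblock p i = [set i; partner p i].
Proof. by case: (partnerP i). Qed.

Lemma partner_sign i : eps (partner p i) = ~~ eps i.
Proof. by case: (partnerP i). Qed.

Lemma partnerK : involutive (partner p).
Proof.
move=> i; have : partner p i \in pblock p i by rewrite pblockE !inE eqxx orbT.
move/(same_pblock pairing_trivIset); rewrite !pblockE => /setP /(_ (partner p (partner p i))).
rewrite !inE eqxx orbT => /esym /orP[/eqP //|/eqP e].
by have := partner_sign (partner p i); rewrite e; case: (eps _).
Qed.

(** A pair meets b in 0, 1 or 2 points, so excluding 1 means that both partners are in b or neither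
    is. *)
Lemma leaves_invariantP (b : {set 'I_k}) :
  reflect (forall i, (partner p i \in b) = (i \in b)) (leaves_invariant p b).
Proof.
apply: (iffP forall_inP) => [inv|inv c cp].
  have sub i : i \in b -> partner p i \in b.
    move=> ib; have := inv _ (pairing_pblock i); rewrite pblockE; apply: contraR => pib.
    rewrite (_ : _ :&: b = [set i]) ?cards1 //; apply/setP => j; rewrite !inE.
    case: eqP => [->|_] /=; first by rewrite ib.
    by apply/negP => /andP[/eqP ->]; rewrite (negbTE pib).
  by move=> i; apply/idP/idP => [/sub|]; [rewrite partnerK|exact: sub].
have /set0Pn[i ic] : c != set0.
  by apply: contraTneq cp => ->; rewrite (partition0 pairing_partition).
rewrite -(def_pblock pairing_trivIset cp ic) pblockE.
have pii : i != partner p i.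
  by apply/eqP => e; have := partner_sign i; rewrite -e; case: (eps i).
have -> : [set i; partner p i] :&: b = if i \in b then [set i; partner p i] else set0.
  apply/setP => j; case: ifP => ib; rewrite !inE.
    by rewrite andb_idr // => /orP[] /eqP ->; rewrite ?inv.
  by apply/negP => /andP[/orP[] /eqP ->]; rewrite ?inv ib.
by case: ifP; rewrite ?cards2 ?pii ?cards0.
Qed.

Lemma partner_restrict (b : {set 'I_k}) i : leaves_invariant p b -> i \in b ->
  partner (p ::&: b) i = partner p i.
Proof.
move=> /leaves_invariantP inv ib; rewrite /partner.
suff -> : pblock (p ::&: b) i = pblock p i by [].
have ip : i \in pblock p i by rewrite mem_pblock pairing_cover.
apply: def_pblock => //; first by apply: trivIsetS pairing_trivIset; by apply/subsetP => c; rewrite inE => /andP[].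
rewrite !inE pairing_pblock pblockE; apply/subsetP => j; rewrite !inE.
by case/orP => /eqP ->; rewrite ?inv.
Qed.

End Partner.

Section Quotient.
Variables (k : nat) (eps : {ffun 'I_k -> bool}) (p q : {set {set 'I_k}}).
Hypotheses (p_pairing : p \in pairings eps) (q_pairing : q \in pairings eps).

(** The composite of the two partner maps is an injective self-map of the minuses of b, so the
    choice never takes its default. Allowing p' and q' that agree with p and q on b covers
    restricted pairings too. *)
Lemma pairing_quotient_val (b : {set 'I_k}) (p' q' : {set {set 'I_k}}) :
    leaves_invariant p b -> leaves_invariant q b ->
    {in b, partner p' =1 partner p} -> {in b, partner q' =1 partner q} ->
  forall j : minus_in eps b,
    val (pairing_quotient eps b p' q' j) = partner p (partner q (val j)).
Proof.
move=> /(leaves_invariantP p_pairing) ip /(leaves_invariantP q_pairing) iq pp qq.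
have fP (j : minus_in eps b) : let i := partner p (partner q (val j)) in (i \in b) && ~~ eps i.
  have /andP[jb je] := valP j.
  by rewrite /= ip iq jb (partner_sign p_pairing) (partner_sign q_pairing) negbK.
pose f (j : minus_in eps b) : minus_in eps b :=
  exist (fun i => (i \in b) && ~~ eps i) _ (fP j).
have fI : injective f.
  move=> i j /(congr1 val) /= /(can_inj (partnerK p_pairing)) /(can_inj (partnerK q_pairing)).
  exact: val_inj.
have E (j : minus_in eps b) : partner p' (partner q' (val j)) = partner p (partner q (val j)).
  by have /andP[jb je] := valP j; rewrite qq // pp // iq.
rewrite /pairing_quotient; case: pickP => [s /forallP sE|/(_ (perm fI)) /negbT/negP no] j.
  by rewrite (eqP (sE j)) E.
by case: no; apply/forallP => l; rewrite permE E.
Qed.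

Lemma leaves_invariantT (r : {set {set 'I_k}}) : r \in pairings eps -> leaves_invariant r [set: 'I_k].
Proof. by move=> rp; apply/(leaves_invariantP rp) => i; rewrite !inE. Qed.

(** A block of the join contains the whole pair of each of its points, hence so does a union of
    blocks. *)
Lemma restrictible_invariant T (pi : 'I_T -> {set 'I_k}) t :
  pi t != set0 -> t \in restrictible_blocks pi p q ->
  leaves_invariant p (pi t) && leaves_invariant q (pi t).
Proof.
rewrite inE /pjoin; case: pickP => [J /and4P[Jpart pJ qJ _]|_] pi0 /existsP[B /andP[/= BJ /eqP pB]]; last first.
  (* With the default value of [pjoin], the block would be empty. *)
  move: BJ pi0; rewrite subset0 => /eqP B0.
  by rewrite pB B0 /cover big_set0 eqxx.
have inv r : r \in pairings eps -> refines r J -> leaves_invariant r (pi t).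
  move=> rp rJ; have ri := pairing_pblock rp.
  have sub i : i \in pi t -> partner r i \in pi t.
    rewrite pB => /bigcupP[c cB ic]; apply/bigcupP; exists c => //.
    have /forall_inP/(_ _ (ri i))/exists_inP[c' c'J sc'] := rJ.
    have ipi : i \in pblock r i by rewrite (pblockE rp) !inE eqxx.
    have tJ : trivIset J by case/and3P: Jpart.
    rewrite -(def_pblock tJ (subsetP BJ _ cB) ic).
    rewrite (def_pblock tJ c'J (subsetP sc' _ ipi)); apply: (subsetP sc').
    by rewrite (pblockE rp) !inE eqxx orbT.
  by apply/(leaves_invariantP rp) => i; apply/idP/idP => [/sub|/sub //]; rewrite (partnerK rp).
by rewrite !inv.
Qed.

End Quotient.

(** * The centered Weingarten function as a centered sum *)

Section CenteredWg.
Variables (R : realFieldType) (Wg : forall S : finType, {perm S} -> R).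
Variables (k T : nat) (pi : 'I_T -> {set 'I_k}) (eps : {ffun 'I_k -> bool}).
Variables (p q : {set {set 'I_k}}).
Hypothesis pi_blocks : blocks_partition pi.
Hypotheses (p_pairing : p \in pairings eps) (q_pairing : q \in pairings eps).

Lemma block_exists i : exists t, i \in pi t.
Proof.
case: pi_blocks => _ /cover_partition /setP /(_ i); rewrite inE => /bigcupP[b /imsetP[t _ ->] ib].
by exists t.
Qed.

Definition block_of (i : 'I_k) : 'I_T := xchoose (block_exists i).

Lemma mem_block i t : (i \in pi t) = (block_of i == t).
Proof.
have ib : i \in pi (block_of i) := xchooseP (block_exists i).
apply/idP/eqP => [it|<-//]; case: pi_blocks => piI /and3P[_ tI _].
apply: piI; rewrite -(def_pblock tI _ ib) ?imset_f //.
by rewrite (def_pblock tI _ it) ?imset_f.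
Qed.

Lemma block_neq0 t : pi t != set0.
Proof.
case: pi_blocks => _ P; apply/eqP => e; have := partition0 P.
by rewrite -e imset_f.
Qed.

Let X := minus_in eps [set: 'I_k].
Let sigma : {perm X} := pairing_quotient eps [set: 'I_k] p q.

Definition minus_block (x : X) : 'I_T := block_of (val x).

(** Initial value of Z: the product for A vanishes as soon as an unmerged block is not in this
    set. *)
Definition invariant_blocks : {set 'I_T} :=
  [set t | leaves_invariant p (pi t) && leaves_invariant q (pi t)].

Lemma sigma_val x : val (sigma x) = partner p (partner q (val x)).
Proof.
exact: (pairing_quotient_val p_pairing q_pairing (leaves_invariantT p_pairing) (leaves_invariantT q_pairing)).
Qed.

Lemma stable_invariant_blocks :
  stable_colors minus_block invariant_blocks sigma = invariant_blocks.
Proof.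
apply/setP => t; rewrite inE andb_idr // => /[!inE] /andP[].
move=> /(leaves_invariantP p_pairing) ip /(leaves_invariantP q_pairing) iq.
by apply/forallP => x; rewrite /minus_block -!mem_block sigma_val ip iq.
Qed.

Lemma restrictible_sub_invariant : restrictible_blocks pi p q \subset invariant_blocks.
Proof.
apply/subsetP => t tr; rewrite inE.
by apply: (restrictible_invariant p_pairing q_pairing) tr; exact: block_neq0.
Qed.

(** The merged block is the complement of the kept ones, so its invariance follows from theirs. *)
Lemma merged_invariant (B : {set 'I_T}) :
  [forall b in merge_blocks pi (~: B), leaves_invariant p b && leaves_invariant q b]
  = (B \subset invariant_blocks).
Proof.
apply/forall_inP/subsetP => [inv t tB|BZ b].
  by rewrite inE; apply: inv; rewrite inE imset_f // setCK.
rewrite inE => /orP[/imsetP[t + ->]|]; first by rewrite setCK => /BZ; rewrite inE.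
case: ifP => _; rewrite inE // => /eqP ->.
have memU i : (i \in \bigcup_(t in ~: B) pi t) = (block_of i \notin B).
  apply/bigcupP/idP => [[t]|iB]; first by rewrite inE mem_block => tB /eqP ->.
  by exists (block_of i); rewrite ?inE // mem_block.
have stab r : r \in pairings eps -> (forall t, t \in B -> leaves_invariant r (pi t)) ->
    leaves_invariant r (\bigcup_(t in ~: B) pi t).
  move=> rp rB; apply/(leaves_invariantP rp) => i; rewrite !memU; congr (~~ _).
  have inv t : t \in B -> (block_of (partner r i) == t) = (block_of i == t).
    by move=> /rB /(leaves_invariantP rp) /(_ i); rewrite !mem_block.
  apply/idP/idP => iB; first by have := inv _ iB; rewrite eqxx => /esym/eqP ->.
  by have := inv _ iB; rewrite eqxx => /eqP ->.
by rewrite !stab // => t /BZ; rewrite inE => /andP[].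
Qed.

Variable F : {set X} -> {perm X} -> R.
Hypothesis F_nil : forall s, F set0 s = 1.
Hypothesis Wg_F : forall b : {set 'I_k}, leaves_invariant p b -> leaves_invariant q b ->
  Wg (pairing_quotient eps b (p ::&: b) (q ::&: b)) = F [set x : X | val x \in b] sigma.

Lemma WgA_color_product (B : {set 'I_T}) :
  WgA Wg eps pi (~: B) p q =
  if B \subset invariant_blocks then color_product F (keep_colors minus_block B) [set: X] sigma
  else 0.
Proof.
rewrite /WgA merged_invariant; case: ifP => // BZ.
have := merged_invariant B; rewrite BZ => /forall_inP inv.
under eq_bigr => b bB do rewrite (Wg_F (proj1 (andP (inv b bB))) (proj2 (andP (inv b bB)))).
rewrite /color_product.
have -> : [forall x, keep_colors minus_block B (sigma x) == keep_colors minus_block B x].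
  apply/forallP => x; rewrite /keep_colors.
  have st t : t \in B -> (minus_block (sigma x) == t) = (minus_block x == t).
    move=> /(subsetP BZ); rewrite -stable_invariant_blocks inE => /andP[_ /forallP/(_ x)].
    by move/eqP.
  case: ifP => sB; first by have := st _ sB; rewrite eqxx => /esym/eqP ->; rewrite sB.
  by case: ifP => // xB; have := st _ xB; rewrite eqxx => /eqP e; rewrite e xB in sB.
rewrite mul1r (bigD1 None) //=.
have -> : \prod_(u | u != None) F ([set: X] :&: [set x | keep_colors minus_block B x == u]) sigma =
    \prod_(t in B) F [set x : X | val x \in pi t] sigma.
  (* Colors outside B have an empty fibre, on which F is 1. *)
  rewrite (reindex_omap Some id) /= => [|[]//]; rewrite [RHS]big_mkcond /=.
  apply: eq_big => [t|t _]; first by rewrite eqxx.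
  case: ifP => tB.
    congr (F _ sigma); apply/setP => x; rewrite !inE mem_block -/(minus_block x) /keep_colors.
    case: ifP => xB; first by rewrite /eq_op.
    by apply/esym/negbTE; apply: contraFneq xB => ->.
  rewrite (_ : _ :&: _ = set0) ?F_nil //; apply/setP => x; rewrite !inE /keep_colors.
  by case: ifP => // xB; apply/negbTE; apply: contraFneq tB => -[<-].
rewrite /merge_blocks setCK; set U := \bigcup_(t in ~: B) pi t.
have memU x : (val x \in U) = (minus_block x \notin B).
  apply/bigcupP/idP => [[t]|xB]; first by rewrite inE mem_block /minus_block => tB /eqP ->.
  by exists (minus_block x); rewrite ?inE // mem_block.
have inj : {in B &, injective pi} by case: pi_blocks => piI _ ? ? _ _ /piI.
have -> : [set: X] :&: [set x | keep_colors minus_block B x == None] = [set x : X | val x \in U].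
  by apply/setP => x; rewrite !inE memU /keep_colors; case: ifP.
(* When nothing is merged, no extra block is created and the fibre of [None] is empty. *)
case: ifP => [/eqP CB|/negbT CB].
  rewrite setU0 big_imset // -[LHS]mul1r; congr (_ * _).
  rewrite (_ : [set x | _] = set0) ?F_nil //; apply/setP => x.
  by rewrite !inE /U CB big_set0 inE.
rewrite setUC big_setU1 /=; last first.
  apply/imsetP => -[t tB e]; have /set0Pn[i it] := block_neq0 t.
  have : i \in U by rewrite e.
  case/bigcupP => t'; rewrite inE mem_block => t'B /eqP it'.
  by move: it; rewrite mem_block it' => /eqP e'; rewrite e' tB in t'B.
by rewrite big_imset.
Qed.

(** Complementation turns T - #|A| into #|B|, and only subsets B of [invariant_blocks]
    contribute. *)
Lemma centered_WgE :
  centered_Wg Wg eps pi p q = centered_sum F minus_block invariant_blocks [set: X] sigma.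
Proof.
rewrite /centered_Wg (reindex_inj (inv_inj (@setCK _))) /= /centered_sum [RHS]big_mkcond /=.
apply: eq_bigr => B _; rewrite WgA_color_product -[T in (T - _)%N]card_ord -cardsCs.
by case: ifP => _; rewrite ?mulr0.
Qed.

End CenteredWg.

(** * Moments of Haar unitaries *)

From mathcomp Require Import spectral complex.
From mathcomp Require Import all_classical all_reals all_analysis measurable_realfun.
Import Order.TTheory GRing.Theory Num.Theory numFieldNormedType.Exports.
Local Open Scope ring_scope.
Local Open Scope complex_scope.

(** * Expectations of bounded complex variables *)

Section ComplexExpectation.
Local Open Scope classical_set_scope.
Context (d : measure_display) (Omega : measurableType d) (R : realType).
Variable P : probability Omega R.
Implicit Types f g : Omega -> R[i].

(** These functions are integrable and closed under products, so polynomials in the entries of U can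
    be expanded under the expectation. *)
Definition bounded_rv (f : Omega -> R) : Prop :=
  measurable_fun [set: Omega] f /\ exists M : R, forall w, `|f w| <= M.

Lemma bounded_rv_integrable (f : Omega -> R) : bounded_rv f ->
  P.-integrable [set: Omega] (EFin \o f).
Proof.
move=> [mf [M fM]]; apply: measurable_bounded_integrable => //.
  by rewrite [X in (X < _)%E]probability_setT ltry.
exists M; split; first exact: num_real.
by move=> x Mx w _; exact: le_trans (fM w) (ltW Mx).
Qed.

Lemma bounded_rvD (f g : Omega -> R) : bounded_rv f -> bounded_rv g ->
  bounded_rv (fun w => f w + g w).
Proof.
move=> [mf [M fM]] [mg [N gN]]; split; first exact: measurable_funD.
by exists (M + N) => w; rewrite (le_trans (ler_normD _ _)) ?lerD.
Qed.

Lemma bounded_rvM (f g : Omega -> R) : bounded_rv f -> bounded_rv g ->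
  bounded_rv (fun w => f w * g w).
Proof.
move=> [mf [M fM]] [mg [N gN]]; split; first exact: measurable_funM.
by exists (M * N) => w; rewrite normrM ler_pM.
Qed.

Lemma bounded_rvN (f : Omega -> R) : bounded_rv f -> bounded_rv (fun w => - f w).
Proof.
move=> [mf [M fM]]; split; first exact: measurable_funN.
by exists M => w; rewrite normrN.
Qed.

Lemma expectation_add (f g : Omega -> R) : bounded_rv f -> bounded_rv g ->
  fine ('E_P[fun w => (f w + g w)%R])%E = fine ('E_P[f])%E + fine ('E_P[g])%E.
Proof.
move=> /bounded_rv_integrable fi /bounded_rv_integrable gi; rewrite unlock.
rewrite -fineD ?integrable_fin_num // -integralD_EFin //.
Qed.

Definition bounded_crv f : Prop :=
  bounded_rv (fun w => complex.Re (f w)) /\ bounded_rv (fun w => complex.Im (f w)).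

Lemma bounded_crv_cst (z : R[i]) : bounded_crv (fun _ => z).
Proof.
by split; split; [exact: measurable_cst|exists `|complex.Re z| | exact: measurable_cst|exists `|complex.Im z|].
Qed.

Lemma bounded_crvD f g : bounded_crv f -> bounded_crv g -> bounded_crv (fun w => f w + g w).
Proof.
move=> [fr fi] [gr gi]; split.
  by under eq_fun => w do rewrite raddfD; exact: bounded_rvD.
by under eq_fun => w do rewrite raddfD; exact: bounded_rvD.
Qed.

Lemma bounded_crvM f g : bounded_crv f -> bounded_crv g -> bounded_crv (fun w => f w * g w).
Proof.
move=> [fr fi] [gr gi]; split.
  rewrite (_ : (fun w => _) = fun w => complex.Re (f w) * complex.Re (g w) + - (complex.Im (f w) * complex.Im (g w))).
    by apply: bounded_rvD; [|apply: bounded_rvN]; exact: bounded_rvM.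
  by apply/funext => w; case: (f w) (g w) => a b [].
rewrite (_ : (fun w => _) = fun w => complex.Re (f w) * complex.Im (g w) + complex.Im (f w) * complex.Re (g w)).
  by apply: bounded_rvD; exact: bounded_rvM.
by apply/funext => w; case: (f w) (g w) => a b [].
Qed.

Lemma bounded_crv_conj f : bounded_crv f -> bounded_crv (fun w => (f w)^*).
Proof.
move=> [fr fi]; split.
  by rewrite (_ : (fun w => _) = fun w => complex.Re (f w)) //; apply/funext => w; case: (f w).
rewrite (_ : (fun w => _) = fun w => - complex.Im (f w)); first exact: bounded_rvN.
by apply/funext => w; case: (f w).
Qed.

Lemma bounded_crv_prod (I : finType) (Q : pred I) (f : I -> Omega -> R[i]) :
  (forall i, bounded_crv (f i)) -> bounded_crv (fun w => \prod_(i | Q i) f i w).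
Proof.
move=> fb; elim: (index_enum I) => [|i r IH].
  by under eq_fun => w do rewrite big_nil; exact: bounded_crv_cst.
under eq_fun => w do rewrite big_cons.
by case: (Q i) => //; exact: bounded_crvM.
Qed.

Lemma cexpectation1 : cexpectation P (fun _ => 1) = 1.
Proof. by rewrite /cexpectation /= !expectation_cst. Qed.

Lemma cexpectationD f g : bounded_crv f -> bounded_crv g ->
  cexpectation P (fun w => f w + g w) = cexpectation P f + cexpectation P g.
Proof.
move=> [fr fi] [gr gi]; rewrite /cexpectation.
under eq_fun => w do rewrite raddfD.
under [X in _ +i* fine 'E__[X]]eq_fun => w do rewrite raddfD.
by rewrite !expectation_add.
Qed.

End ComplexExpectation.

Lemma cexpectation_sum (d : measure_display) (Omega : measurableType d) (R : realType)
    (P : probability Omega R) (I : finType) (Q : pred I) (f : I -> Omega -> R[i]) :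
  (forall i, bounded_crv (f i)) ->
  cexpectation P (fun w => \sum_(i | Q i) f i w) = \sum_(i | Q i) cexpectation P (f i).
Proof.
move=> fb; pose S r w := \sum_(i <- r | Q i) f i w.
suff [] : bounded_crv (S (index_enum I)) /\
    cexpectation P (S (index_enum I)) = \sum_(i | Q i) cexpectation P (f i) by [].
elim: (index_enum I) => [|i r [IHb IH]].
  rewrite /S; under eq_fun => w do rewrite big_nil.
  split; first exact: bounded_crv_cst.
  by rewrite big_nil /cexpectation /= !expectation_cst.
rewrite /S; under eq_fun => w do rewrite big_cons.
rewrite big_cons; case: (Q i) => //; split; first exact: bounded_crvD.
by rewrite cexpectationD // IH.
Qed.

(** * Entries of a Haar unitary matrix *)

Section Entries.
Local Open Scope classical_set_scope.
Variable R : realType.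

Lemma continuous_Re : continuous (@complex.Re R : (R[i] : numFieldType) -> R).
Proof.
move=> x s /= /(nbhs_ballP (complex.Re x)) [e e0 es]; apply/nbhs_ballP.
exists e%:C; first by rewrite /= ltcR.
move=> y xy; apply: es; rewrite /ball /= -raddfB.
have : `|x - y| < e%:C :> R[i] := xy.
rewrite normc_def ltcR; apply: le_lt_trans.
by rewrite -sqrtr_sqr ler_wsqrtr // lerDl sqr_ge0.
Qed.

Lemma continuous_Im : continuous (@complex.Im R : (R[i] : numFieldType) -> R).
Proof.
move=> x s /= /(nbhs_ballP (complex.Im x)) [e e0 es]; apply/nbhs_ballP.
exists e%:C; first by rewrite /= ltcR.
move=> y xy; apply: es; rewrite /ball /= -raddfB.
have : `|x - y| < e%:C :> R[i] := xy.
rewrite normc_def ltcR; apply: le_lt_trans.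
by rewrite -sqrtr_sqr ler_wsqrtr // lerDr sqr_ge0.
Qed.

Context (d : measure_display) (Omega : measurableType d) (n : nat).
Variables (P : probability Omega R) (U : Omega -> 'M[R[i]]_n).
Hypothesis haarU : haar_distributed P U.

Lemma measurable_entry (g : (R[i] : numFieldType) -> R) i j : continuous g ->
  measurable_fun [set: Omega] (fun w => g (U w i j)).
Proof.
move=> cg; apply: (measurability _ (RGenOpens.measurableE R)) => _ [_ [a [b ->] <-]].
rewrite setTI; case: haarU => _ mU _.
apply: (mU ((fun M : 'M[(R[i] : numFieldType)]_n => g (M i j)) @^-1` `]a, b[)).
apply: sub_sigma_algebra.
have /continuousP : continuous (fun M : 'M[(R[i] : numFieldType)]_n => g (M i j)).
  by move=> M; apply: (continuous_comp (@coord_continuous _ _ _ i j M)); exact: cg.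
by apply; exact: interval_open.
Qed.

Lemma unitary_rows w i i' : \sum_j U w i j * (U w i' j)^* = (i == i')%:R.
Proof.
case: haarU => /(_ w) /unitarymxP /matrixP /(_ i i') + _ _.
by rewrite !mxE => <-; apply: eq_bigr => j _; rewrite !mxE.
Qed.

(** A row of a unitary matrix has norm 1, so its entries have modulus at most 1. *)
Lemma bounded_entry i j : bounded_crv (fun w => U w i j).
Proof.
have le1 w : complex.Re (U w i j) ^+ 2 + complex.Im (U w i j) ^+ 2 <= 1.
  have /(congr1 (@complex.Re R)) := unitary_rows w i i; rewrite eqxx raddf_sum /= => <-.
  rewrite (bigD1 j) //= -[leLHS]addr0 lerD //.
    by case: (U w i j) => a b /=; rewrite mulrN opprK -!expr2.
  by apply: sumr_ge0 => l _; case: (U w i l) => a b /=; rewrite mulrN opprK -!expr2 addr_ge0 ?sqr_ge0.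
have sqr_le1 (x : R) : x ^+ 2 <= 1 -> `|x| <= 1 by move=> x1; rewrite -(@expr_le1 _ 2) ?normr_ge0 // real_normK ?num_real.
split; split.
- by apply: measurable_entry; exact: continuous_Re.
- exists 1 => w; apply/sqr_le1/le_trans/(le1 w); by rewrite lerDl sqr_ge0.
- by apply: measurable_entry; exact: continuous_Im.
- exists 1 => w; apply/sqr_le1/le_trans/(le1 w); by rewrite lerDr sqr_ge0.
Qed.

End Entries.

Lemma prod_indicator (R : nzRingType) (I : finType) (b : pred I) :
  \prod_(i : I) (b i)%:R = [forall i, b i]%:R :> R.
Proof.
case: forallP => [h|/forallP]; first by rewrite big1 // => i _; rewrite h.
rewrite negb_forall => /existsP[i /negbTE bi].
(* Multiplication may be noncommutative, so the vanishing factor is left in place and the product is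
   treated by induction on the list. *)
suff : forall r : seq I, i \in r -> \prod_(k <- r) (b k)%:R = 0 :> R by apply; rewrite mem_index_enum.
elim=> // k r IH; rewrite in_cons big_cons => /orP[/eqP <-|/IH ->]; last by rewrite mulr0.
by rewrite bi mul0r.
Qed.

Lemma sum_perm_indicator (R : nzRingType) (S : finType) (T : eqType) (f g : S -> T)
    (s : {perm S}) (h : {perm S} -> R) :
  injective g -> f =1 g \o s ->
  \sum_(p : {perm S}) (\prod_l (f l == g (p l))%:R) * h p = h s.
Proof.
move=> gI fg; rewrite (bigD1 s) //= [X in X * _]big1 ?mul1r => [|l _]; last by rewrite fg eqxx.
rewrite big1 ?addr0 // => p ps; rewrite prod_indicator.
case: forallP => [e|_]; last by rewrite mul0r.
by case/eqP: ps; apply/permP => l; apply: gI; rewrite -(eqP (e l)) fg.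
Qed.

(* The index function that agrees with iota except at m, where it is j, is preserved only by
   the identity and, when j = iota i, by the transposition (i m). *)
Lemma sum_perm_collision (R : nzRingType) (S : finType) (T : eqType) (iota : S -> T) (m : S)
    (j : T) (h : {perm S} -> R) : injective iota ->
  let y l := if l == m then j else iota l in
  \sum_(q : {perm S}) (\prod_l (y l == y (q l))%:R) * h q =
  h 1%g + \sum_(i | (i != m) && (iota i == j)) h (tperm i m).
Proof.
move=> iI y; case: (pickP (fun i => (i != m) && (iota i == j))) => [i /andP[im /eqP ij]|no].
  rewrite (big_pred1 i) => [|k]; last first.
    apply/andP/eqP => [[_ /eqP]|->]; last by rewrite ij.
    by rewrite -ij => /iI.
  have t1 : tperm i m != 1%g.
    by apply: contraNneq im => /permP /(_ i); rewrite tpermL perm1 => ->.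
  rewrite (bigD1 1%g) //= (bigD1 (tperm i m)) //= addrA.
  have ym : y m = iota i by rewrite /y eqxx ij.
  have yn l : l != m -> y l = iota l by rewrite /y => /negbTE ->.
  rewrite !prod_indicator big1 ?addr0 => [|q /andP[q1 qt]].
    have -> : [forall l, y l == y ((1%g : {perm S}) l)] by apply/forallP => l; rewrite perm1.
    have -> : [forall l, y l == y (tperm i m l)].
      by apply/forallP => l; case: tpermP => [->|->|//]; rewrite ym yn.
    by rewrite !mul1r.
  rewrite prod_indicator; case: forallP => [e|_]; last by rewrite mul0r.
  have yI a b : y a == y b -> a != m -> b != m -> a = b.
    by move=> ab am bm; apply: iI; rewrite -(yn a) // -(yn b) // (eqP ab).
  have fix_other l : l != m -> l != i -> q l = l.
    move=> lm li; have [qm|qm] := eqVneq (q l) m; last exact/esym/(yI _ _ (e l)).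
    by have := e l; rewrite qm ym yn // (inj_eq iI) (negbTE li).
  have [qm|qm] := eqVneq (q m) m.
    case/eqP: q1; apply/permP => l; rewrite perm1.
    have [->//|lm] := eqVneq l m; have [->|li] := eqVneq l i; last exact: fix_other.
    by rewrite -(yI _ _ (e i)) // -qm (inj_eq perm_inj).
  have qmi : q m = i.
    by have := e m; rewrite ym yn // (inj_eq iI) => /eqP.
  case/eqP: qt; apply/permP => l; case: tpermP => [->|->|/eqP li /eqP lm]; last 2 first.
  - by [].
  - exact: fix_other.
  apply: contraNeq (im) => qim; rewrite -(inj_eq (@perm_inj _ q)) qmi.
  by rewrite -(yI _ _ (e i)).
(* No other index takes the value j, so y is injective and only the identity preserves it. *)
rewrite [X in _ + X]big_pred0 // addr0; apply: (sum_perm_indicator (f := y)) => [a b|l]; last by rewrite /= perm1.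
rewrite /y; have [->|am] := eqVneq a m; have [->|bm] := eqVneq b m => //; last exact: iI.
- by move=> e; have := no b; rewrite bm e eqxx.
- by move=> e; have := no a; rewrite am -e eqxx.
Qed.

(** * Weingarten values as moments and their recursion *)

Section Moments.
Context (R : realType) (d : measure_display) (Omega : measurableType d) (n : nat).
Variables (P : probability Omega R) (U : Omega -> 'M[R[i]]_n).
Variable Wg : forall S : finType, {perm S} -> R.
Hypothesis haarU : haar_distributed P U.
Hypothesis wgU : weingarten_family P U Wg.

(* Choosing injective index functions isolates a single Weingarten value; written this way it
   makes sense on all subsets of one finite type at once. *)
Definition moment (X : finType) (iota : X -> 'I_n) (D : {set X}) (s : {perm X}) : R :=
  complex.Re (cexpectation P (fun w =>
    \prod_(l in D) (U w (iota l) (iota l) * (U w (iota l) (iota (s l)))^*))).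

Lemma moment_set0 (X : finType) (iota : X -> 'I_n) s : moment iota finset.set0 s = 1.
Proof.
rewrite /moment; under eq_fun => w do rewrite big_set0.
by rewrite cexpectation1.
Qed.

Lemma moment_local (X : finType) (iota : X -> 'I_n) (D : {set X}) (s t : {perm X}) :
  {in D, s =1 t} -> moment iota D s = moment iota D t.
Proof.
move=> st; rewrite /moment; congr (complex.Re (cexpectation P _)); apply/funext => w.
by apply: eq_bigr => l lD; rewrite st.
Qed.

(** Injective row indices, permuted by s^-1 in the conjugate factors, leave only p = s in the double
    sum. *)
Lemma weingarten_expansion (S : finType) (f g : S -> 'I_n) (s : {perm S}) :
  (#|S| <= n)%N -> injective f ->
  cexpectation P (fun w => \prod_l (U w (f l) (g l) * (U w (f ((s^-1)%g l)) (g l))^*)) =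
  \sum_(q : {perm S}) (\prod_l (g l == g (q l))%:R) * (Wg (q^-1 * s)%g)%:C.
Proof.
move=> Sn fI; have [_ wg] := wgU Sn; rewrite (wg f g (f \o (s^-1)%g) g).
rewrite exchange_big /=; apply: eq_bigr => q _.
under eq_bigr => p _ do rewrite -mulrA.
apply: (@sum_perm_indicator _ _ _ f (f \o (s^-1)%g) s
  (fun p => (\prod_l (g l == g (q l))%:R) * (Wg (q^-1 * p)%g)%:C)) => [|l].
  by apply: inj_comp => //; exact: perm_inj.
by rewrite /= permK.
Qed.

(** Injective column indices leave only q = 1 as well. Transport along j places the Weingarten
    functions of different types S on subsets of one type X. *)
Lemma weingarten_moment (X S : finType) (iota : X -> 'I_n) (j : S -> X) (D : {set X})
    (s : {perm S}) (t : {perm X}) : injective iota -> injective j ->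
  j @: [set: S] = D -> (forall l, j (s l) = t (j l)) -> Wg s = moment iota D t.
Proof.
move=> iI jI <- st; have ijI : injective (iota \o j) by exact: inj_comp.
have Sn : (#|S| <= n)%N by rewrite -[n in (_ <= n)%N]card_ord (leq_card _ ijI).
have := weingarten_expansion (iota \o j) s Sn ijI.
rewrite (@sum_perm_indicator _ _ _ (iota \o j) (iota \o j) 1%g (fun q => (Wg (q^-1 * s)%g)%:C)) //; last first.
  by move=> l; rewrite /= perm1.
rewrite invg1 mul1g => /(congr1 (@complex.Re R)) /= <-.
rewrite /moment; congr (complex.Re (cexpectation P _)); apply/funext => w.
rewrite big_imset /=; last by move=> ? ? _ _ /jI.
rewrite [RHS](eq_bigl predT) => [|l]; last by rewrite inE.
rewrite !big_split /=; congr (_ * _).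
by rewrite (reindex_inj (@perm_inj _ s)) /=; apply: eq_bigr => l _; rewrite permK st.
Qed.

(** The column index at m runs over all j. By [sum_perm_collision] each j yields Wg s, plus a
    transposed term when j = iota i; under the expectation, rows m and s^-1 m are orthonormal, which
    gives the indicator of s m = m. *)
Lemma weingarten_orthogonality (S : finType) (iota : S -> 'I_n) (s : {perm S}) (m : S) :
  injective iota ->
  n%:R * Wg s + \sum_(i | i != m) Wg (tperm i m * s)%g =
  (s m == m)%:R * complex.Re (cexpectation P (fun w =>
    \prod_(l | l != m) (U w (iota l) (iota l) * (U w (iota l) (iota (s l)))^*))).
Proof.
move=> iI; have Sn : (#|S| <= n)%N by rewrite -[n in (_ <= n)%N]card_ord (leq_card _ iI).
pose y j l := if l == m then j else iota l.
have ym j : y j m = j by rewrite /y eqxx.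
have yn j l : l != m -> y j l = iota l by rewrite /y => /negbTE ->.
pose E j w := \prod_l (U w (iota l) (y j l) * (U w (iota ((s^-1)%g l)) (y j l))^*).
have bE j : bounded_crv (E j).
  apply: bounded_crv_prod => l; apply: bounded_crvM; first exact: bounded_entry haarU _ _.
  by apply: bounded_crv_conj; exact: bounded_entry haarU _ _.
have lhs : \sum_j cexpectation P (E j) = (n%:R * Wg s + \sum_(i | i != m) Wg (tperm i m * s)%g)%:C.
  transitivity (\sum_j (Wg s + \sum_(i | (i != m) && (iota i == j)) Wg (tperm i m * s)%g)%:C).
    apply: eq_bigr => j _; rewrite weingarten_expansion //.
    rewrite (sum_perm_collision m j (fun q => (Wg (q^-1 * s)%g)%:C) iI) invg1 mul1g rmorphD rmorph_sum.
    by congr (_ + _); apply: eq_bigr => i _; rewrite tpermV.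
  rewrite -rmorph_sum big_split /= sumr_const card_ord mulr_natl; congr (_ + _)%:C.
  rewrite (exchange_big_dep (fun i => i != m)) /=; last by move=> j i _ /andP[].
  by apply: eq_bigr => i im; under eq_bigl => j do rewrite im eq_sym; rewrite big_pred1_eq.
rewrite -[LHS]/(complex.Re (_%:C)) -lhs.
rewrite -cexpectation_sum //.
have rhs w : \sum_j E j w = (s m == m)%:R *
    \prod_(l | l != m) (U w (iota l) (iota l) * (U w (iota l) (iota (s l)))^*).
  under [LHS]eq_bigr => j _.
    rewrite /E (bigD1 m) //= mulrC ym.
    under eq_bigr => l lm do rewrite (yn j l lm).
    over.
  rewrite -mulr_sumr (unitary_rows haarU) (inj_eq iI) mulrC.
  have -> : (m == (s^-1)%g m) = (s m == m) by rewrite -(inj_eq (@perm_inj _ s)) permKV.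
  case: eqP => [sm|_]; last by rewrite !mul0r.
  rewrite !mul1r !big_split /=; congr (_ * _).
  rewrite (reindex_inj (@perm_inj _ s)) /=; apply: eq_big => [l|l _]; last by rewrite permK.
  by rewrite -[in LHS]sm (inj_eq perm_inj).
under eq_fun => w do rewrite rhs.
case: (s m == m); first by under eq_fun => w do rewrite mul1r; rewrite mul1r.
rewrite mul0r; under eq_fun => w do rewrite mul0r.
by rewrite /cexpectation /= expectation_cst.
Qed.

(** Orthogonality is applied to the restriction of s to D, viewed as a permutation of the
    subtype. *)
Lemma moment_rec (X : finType) (iota : X -> 'I_n) (D : {set X}) (s : {perm X}) (m : X) :
  injective iota -> (forall x, x \in D -> s x \in D) -> m \in D ->
  n%:R * moment iota D s + \sum_(i in D :\ m) moment iota D (tperm i m * s)%g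
  = (s m == m)%:R * moment iota (D :\ m) s.
Proof.
move=> iI sD mD; pose S := {x : X | x \in D}.
pose f (l : S) : S := exist _ (s (val l)) (sD _ (valP l)).
have fI : injective f by move=> a b /(congr1 val) /= /perm_inj /val_inj.
pose s' : {perm S} := perm fI; pose m' : S := exist _ m mD.
have valI : injective (iota \o val : S -> 'I_n) by apply: inj_comp => //; exact: val_inj.
have valD : val @: [set: S] = D.
  apply/setP => x; apply/imsetP/idP => [[l _ ->]|xD]; first exact: valP.
  by exists (exist _ x xD); rewrite ?inE.
have wgS (t : {perm S}) (u : {perm X}) : (forall l, val (t l) = u (val l)) -> Wg t = moment iota D u.
  exact: weingarten_moment iI val_inj valD.
have s'E l : val (s' l) = s (val l) by rewrite permE.
have := weingarten_orthogonality s' m' valI.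
rewrite (wgS _ _ s'E) -(inj_eq val_inj) s'E [val m']/= => orth.
have valDm : val @: [set l : S | l != m'] = D :\ m.
  apply/setP => x; rewrite !inE; apply/imsetP/andP => [[l lm ->]|[xm xD]].
    by move: lm; rewrite inE -(inj_eq val_inj); split => //; exact: valP.
  by exists (exist _ x xD); rewrite // inE -(inj_eq val_inj).
have valJ (A : {pred S}) : {in A &, injective (val : S -> X)} by move=> ? ? _ _ /val_inj.
rewrite -valDm big_imset //= (eq_bigl (fun l => l != m')) => [|l]; last by rewrite inE.
rewrite (eq_bigr (fun i => Wg (tperm i m' * s')%g)) => [|i _]; last first.
  by apply/esym/wgS => l; rewrite !permM s'E (inj_tperm _ _ _ val_inj).
rewrite orth valDm; congr (_ * complex.Re (cexpectation P _)); apply/funext => w.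
rewrite -valDm big_imset //=; apply: eq_big => [l|l _]; first by rewrite inE.
by rewrite s'E.
Qed.

End Moments.

(** * The bound *)

Lemma card_minus_in (k : nat) (eps : {ffun 'I_k -> bool}) : balanced eps ->
  k = #|minus_in eps [set: 'I_k]|.*2.
Proof.
move=> /eqP bal; rewrite -{1}[k]card_ord -(cardC (fun i => ~~ eps i)) card_sig -addnn.
congr (_ + _)%N; first by apply: eq_card => i; rewrite !inE.
have -> : #|[predC (fun i => ~~ eps i)]| = #|[set i | eps i]|.
  by apply: eq_card => i; rewrite !inE negbK.
by rewrite bal; apply: eq_card => i; rewrite !inE.
Qed.

Lemma half_powers (R : realType) (k : nat) :
  [/\ (k%:R `^ (7 / 4)) ^+ 2 = k%:R `^ (7 / 2) :> R,
      (k%:R `^ (3 / 2)) ^+ 2 = k%:R ^+ 3 :> R &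
      k%:R `^ (7 / 2) = k%:R ^+ 2 * k%:R `^ (3 / 2) :> R].
Proof.
split.
- by rewrite -powR_mulrn ?powR_ge0 // -powRrM; congr (_ `^ _); field.
- rewrite -powR_mulrn ?powR_ge0 // -powRrM (_ : 3 / 2 * 2 = 3%:R) ?powR_mulrn //; by field.
- rewrite [X in _ `^ X = _](_ : _ = 2%:R + 3 / 2); last by field.
  by rewrite powRD ?powR_mulrn //; apply/implyP => /eqP; lra.
Qed.

Theorem theorem10 (R : realType) (d : measure_display)
    (Omega : measurableType d) (P : probability Omega R)
    (n : nat) (U : Omega -> 'M[R[i]]_n)
    (Wg : forall S : finType, {perm S} -> R)
    (k T : nat) (pi : 'I_T -> {set 'I_k}) (eps : {ffun 'I_k -> bool}) :
  haar_distributed P U ->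
  weingarten_family P U Wg ->
  ~~ odd k ->
  (1 <= n)%N ->
  2 * k%:R `^ (7 / 2) <= n%:R ^+ 2 :> R ->
  blocks_partition pi ->
  balanced eps ->
  forall p q : {set {set 'I_k}},
    p \in pairings eps -> q \in pairings eps ->
    let len := perm_length (pairing_quotient eps [set: 'I_k] p q) in
    let r := #|restrictible_blocks pi p q| in
    `|centered_Wg Wg eps pi p q| <=
      (1 + 3 * k%:R `^ (7 / 2) * n%:R ^- 2) *
      n%:R ^- (k./2 + len) * 4 ^+ len *
      (k%:R `^ (7 / 4) * n%:R^-1) ^+ r.
Proof.
move=> haarU wgU _ n1 kn pi_blocks bal p q pp qp; cbv zeta.
set len := perm_length _; set r := #|restrictible_blocks _ _ _|.
pose X := minus_in eps [set: 'I_k].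
have kX : k = #|X|.*2 := card_minus_in bal.
have [sqrz sqrJ k72] := half_powers R k.
(* With #|X| = k/2 and K = k, these values give J^2 = k^3 = 8 #|X|^3 and z^2 n^2 = k^2 J. The cost
   of the joins is k^2 J (1 + z^2)/2, at most k^2 J since z^2 <= 1/2. *)
set z := k%:R `^ (7 / 4) * n%:R^-1; set J : R := k%:R `^ (3 / 2).
have n0 : (0 : R) < n%:R by rewrite ltr0n.
have z0 : 0 <= z by rewrite mulr_ge0 ?powR_ge0 ?invr_ge0 ?ler0n.
have J0 : 0 <= J by exact: powR_ge0.
have z2 : z ^+ 2 = k%:R `^ (7 / 2) * n%:R ^- 2 by rewrite exprMn sqrz exprVn.
have z2n : z ^+ 2 * n%:R ^+ 2 = k%:R ^+ 2 * J.
  by rewrite z2 mulfVK ?k72 // expf_neq0 // gt_eqF.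
have z2_le : z ^+ 2 <= 1 / 2.
  by rewrite z2 ler_pdivrMr ?exprn_gt0 //; lra.
have kR : (k%:R : R) = 2 * #|X|%:R by rewrite {1}kX -muln2 natrM mulrC.
(* For k >= 1, k^2 <= 2 k^(7/2) <= n^2. This provides the injective index function that defines
   F. *)
have kn' : (k <= n)%N.
  have [->//|k0] := posnP k.
  have k1 : (1 : R) <= k%:R by rewrite ler1n.
  have J1 : 1 <= J by rewrite -(@expr_ge1 _ 2) // sqrJ exprn_ege1.
  rewrite -(ler_nat R) -(@ler_pXn2r _ 2) ?nnegrE ?ler0n //.
  apply: le_trans kn; rewrite k72 -/J mulrCA ler_peMr ?sqr_ge0 //; lra.
have iI : injective (fun x : X => widen_ord kn' (val x)).
  by move=> x y /(congr1 val) /= /val_inj /val_inj.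
pose F := @moment R d Omega n P U X (fun x => widen_ord kn' (val x)).
have FW b : leaves_invariant p b -> leaves_invariant q b ->
    Wg _ (pairing_quotient eps b (p ::&: b) (q ::&: b)) =
    F [set x : X | val x \in b]%SET (pairing_quotient eps [set: 'I_k] p q).
  move=> pb qb; have jP (l : minus_in eps b) : (val l \in [set: 'I_k]) && ~~ eps (val l).
    by have /andP[_ ->] := valP l; rewrite inE.
  pose j (l : minus_in eps b) : X := exist (fun i => (i \in [set: 'I_k]) && ~~ eps i) _ (jP l).
  apply: (weingarten_moment wgU (j := j)) => //.
  - by move=> x y /(congr1 val) /= /val_inj.
  - apply/setP => x; rewrite inE; apply/imsetP/idP => [[l _ ->]|xb].
      by have /andP[] := valP l.
    have xP : (val x \in b) && ~~ eps (val x) by have /andP[_ ->] := valP x; rewrite xb.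
    by exists (exist (fun i => (i \in b) && ~~ eps i) _ xP); rewrite ?inE //; apply: val_inj.
  - move=> l; apply: val_inj; rewrite sigma_val //=.
    by apply: (pairing_quotient_val pp qp pb qb) => i ib; apply: partner_restrict ib => //; [exact: pp|exact: qp].
have F_nil s : F finset.set0 s = 1 by exact: moment_set0.
have F_local (D : {set X}) (s t : {perm X}) : {in D, s =1 t} -> F D s = F D t by exact: moment_local.
have F_rec (D : {set X}) (s : {perm X}) m : (forall x, x \in D -> s x \in D) -> m \in D ->
    n%:R * F D s + \sum_(i in D :\ m) F D (tperm i m * s)%g = (s m == m)%:R * F (D :\ m) s.
  exact: (moment_rec haarU wgU iI).
have nX : #|X|%:R <= n%:R :> R by rewrite ler_nat (leq_trans _ kn') // kX -addnn leq_addr.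
have KX : (#|X|.*2 <= k)%N by rewrite -kX.
have J_ge : 4 * #|X|%:R ^+ 3 <= J ^+ 2.
  by rewrite sqrJ kR exprMn ler_wpM2r ?exprn_ge0 //; lra.
have zJ : #|X|%:R * J * k%:R * (1 + z ^+ 2) <= z ^+ 2 * n%:R ^+ 2.
  rewrite z2n (_ : #|X|%:R = k%:R / 2); last by rewrite kR; field.
  rewrite (_ : _ * _ * _ * _ = k%:R ^+ 2 * J * ((1 + z ^+ 2) / 2)); last by field.
  by rewrite ler_piMr ?mulr_ge0 ?sqr_ge0 //; lra.
rewrite (centered_WgE pi_blocks pp qp F_nil FW).
have son : perm_on [set: X]%SET (pairing_quotient eps [set: 'I_k] p q).
  by apply/fintype.subsetP => x _; rewrite inE.
have := centered_sum_le_majorant F_local F_nil F_rec (minus_block pi_blocks) n0 nX z0 z2_le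
  KX J0 J_ge zJ (invariant_blocks pi p q) son.
move/le_trans; apply.
rewrite /majorant stable_invariant_blocks // cardsT -/len.
have -> : #|X| = k./2 by rewrite kX doubleK.
set e := (k./2 + len)%N; set r' := #|invariant_blocks pi p q|.
have eK : (e <= k)%N.
  rewrite /e kX doubleK -addnn leq_add2l; exact: leq_subr.
(* The majorant carries z^r', where r' counts all invariant blocks; as z <= 1, passing to r only
   enlarges it. *)
have rr' : (r <= r')%N by apply: subset_leq_card; exact: (restrictible_sub_invariant pi_blocks pp qp).
have z1 : z <= 1.
  by rewrite -(@expr_le1 _ 2) // (le_trans z2_le) // ler_pdivrMr // mul1r ler1n.
have ne0 : 0 <= n%:R ^- e :> R by rewrite invr_ge0 exprn_ge0 // ltW.
rewrite -[3 * _ * _]mulrA -z2.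
rewrite [leRHS](_ : _ = n%:R ^- e * 4 ^+ len * (z ^+ r * (1 + 3 * z ^+ 2))); last first.
  by move: (n%:R ^- e : R) (4 ^+ len : R) (z ^+ r) (z ^+ 2) => a b x y; ring.
apply: ler_pM; rewrite ?growth_ge0 ?mulr_ge0 ?cycle_weight_ge0 //.
  by rewrite ler_wpM2l // cycle_weight_le.
apply: (le_trans (growth_le z0 _ eK)).
have zz := sqr_ge0 z.
apply: ler_pM; rewrite ?exprn_ge0 ?ler_wiXn2l ?addr_ge0 //.
by rewrite lerD2l ler_peMl // ler1n.
Qed.
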